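(* There is an absolute constant $\epsilon_0 \geq 9.4\cdot 10^{-5}$ such that for every graph $G$ on $n$ vertices with maximum degree $d$ and every $k \geq (\frac{11}{6}-\epsilon_0)d$, the Glauber dynamics on proper $k$-colorings of $G$ is rapidly mixing, with mixing time $O(n^2\log n\log k)$.
   Context: Let $G=(V,E)$ be a graph with $n$ vertices and maximum degree $d$. The Glauber dynamics on $k$-colorings of $G$ is the Markov chain which at each step chooses a uniformly random vertex and recolors it with a uniformly random color not appearing among its neighbors; its stationary distribution is uniform over proper $k$-colorings. The mixing time is $\tau_{mix}=\max_{\sigma^{(0)}}\min\{t : d_{TV}(P^{t'}(\sigma^{(0)},\cdot),\pi)\le 1/(2e)\ \forall t'\ge t\}$, where $P^t(\sigma^{(0)},\cdot)$ is the distribution after $t$ steps and $\pi$ the stationary distribution.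
   Formalization: The formal theorem also assumes n ≥ 2 and k ≥ d+2: for d=1, k=2 an edge is frozen and the chain never mixes, and for n=1 the bound is 0 while the mixing time is 1; besides these, only edgeless graphs with k ≤ 1 are excluded. *)

(* Defs.v *)
From HB Require Import structures.
From mathcomp Require Import all_boot all_order all_algebra.
From mathcomp Require Import reals sequences exp.
Set Implicit Arguments. Unset Strict Implicit. Unset Printing Implicit Defensive.
Import Order.TTheory GRing.Theory Num.Theory.
Local Open Scope ring_scope.

(* A graph is a symmetric irreflexive relation e on a finite vertex type T. *)
Section Glauber.
Variables (R : realType) (T : finType) (e : rel T) (k : nat).

Definition max_degree : nat := (\max_(v : T) #|[set u | e v u]|)%N.

Definition proper_coloring (s : {ffun T -> 'I_k}) : bool :=
  [forall u, forall v, e u v ==> (s u != s v)].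

Definition avail (s : {ffun T -> 'I_k}) (v : T) : {set 'I_k} :=
  [set c : 'I_k | [forall u, e v u ==> (s u != c)]].

(* Glauber transition probability P(s, t): pick a uniform vertex v,
   recolor it with a uniform color from avail s v. *)
Definition glauber_P (s t : {ffun T -> 'I_k}) : R :=
  (#|T|%:R)^-1 *
  \sum_(v : T)
    (if [forall u, (u != v) ==> (t u == s u)] && (t v \in avail s v)
     then (#|avail s v|%:R)^-1 else 0).

Definition glauber_step (mu : {ffun T -> 'I_k} -> R) : {ffun T -> 'I_k} -> R :=
  fun t => \sum_(s : {ffun T -> 'I_k}) mu s * glauber_P s t.

Definition glauber_dist (t : nat) (s0 : {ffun T -> 'I_k}) : {ffun T -> 'I_k} -> R :=
  iter t glauber_step (fun s => if s == s0 then 1 else 0).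

Definition unif_proper : {ffun T -> 'I_k} -> R :=
  fun s => if proper_coloring s
           then (#|[set s' | proper_coloring s']|%:R)^-1 else 0.

End Glauber.

Definition dTV (R : realType) (S : finType) (mu nu : S -> R) : R :=
  2^-1 * \sum_(s : S) `|mu s - nu s|.

(* Main.v *)
Require Import Defs.
From HB Require Import structures.
From mathcomp Require Import all_boot all_order all_algebra perm.
From mathcomp Require Import reals sequences exp.
From mathcomp Require Import zify ring lra.
Set Implicit Arguments. Unset Strict Implicit. Unset Printing Implicit Defensive.
Import Order.TTheory GRing.Theory Num.Theory.
Local Open Scope ring_scope.

(* Flip dynamics: swap the two colours of a maximal two-coloured cluster of size [l <= 6], at rate
   [p l]. Take colorings [s], [t] that differ only at [v] and couple the flips greedily, as
   Vigoda does. With the Hamming metric the drift is nonpositive when k >= 11/6 d, and the only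
   local pictures that forbid a smaller k are a colour seen once around [v] with cluster sizes 1
   and 2, and a colour seen twice with cluster sizes (3,3) and (1,1). Lowering [p 3] below 1/6
   creates slack for the second and a small excess for the first. As in Carlson and Vigoda, that
   excess is compensated by giving the pair the weight 1 - eta U / k, where [U] counts the
   neighbours of [v] that have no further neighbour coloured [s v] or [t v]: in the first picture
   recolouring a single vertex makes a neighbour unblocked, and unblocked neighbours themselves
   have slack. Hence the flip dynamics contracts at rate c/n, with absolute c, as soon as
   k >= (11/6 - 94/10^6) d.

   Contraction on all colorings gives the Poincare inequality of the flip dynamics on proper
   colorings. A flip of a cluster is a bounded sequence of single-site recolourings (move a
   non-cut vertex to a spare colour, flip the rest, give the vertex its final colour), and
   averaging over the spare colour compares the two Dirichlet forms up to an absolute constant.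
   So Glauber dynamics has spectral gap c'/n, and log(1/pi_min) <= n log k gives the mixing
   time. *)

(** * Clusters and flips *)

Section Clusters.
Variables (T : finType) (e : rel T) (k : nat).
Hypothesis esym : symmetric e.
Notation col := {ffun T -> 'I_k}.
Implicit Types (s t : col) (c : 'I_k) (x y v : T).

(* Monochromatic edges are never followed, so clusters make sense in improper colorings too: the
   single-site paths between the colorings compared below leave the proper ones. *)
Definition alt s c1 c2 : rel T := fun x y =>
  [&& e x y, s x != s y, (s x == c1) || (s x == c2) & (s y == c1) || (s y == c2)].
Definition cluster s x c : {set T} := [set y | connect (alt s (s x) c) x y].
Definition swap s (S : {set T}) c1 c2 : col :=
  [ffun y => if y \in S then tperm c1 c2 (s y) else s y].
Definition flip s x c : col := swap s (cluster s x c) (s x) c.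

Lemma alt_sym s c1 c2 : symmetric (alt s c1 c2).
Proof. by move=> x y; rewrite /alt esym eq_sym; do !bool_congr; rewrite andbC. Qed.

Lemma alt_csym s c1 c2 : connect_sym (alt s c1 c2).
Proof. exact: (sym_connect_sym (alt_sym s c1 c2)). Qed.

Lemma altC s c1 c2 : alt s c1 c2 =2 alt s c2 c1.
Proof. by move=> x y; rewrite /alt (orbC (s x == c1)) (orbC (s y == c1)). Qed.

Lemma cluster_refl s x c : x \in cluster s x c.
Proof. by rewrite inE connect0. Qed.

Lemma cluster_min s x c (A : {set T}) :
  x \in A -> (forall y z, y \in A -> alt s (s x) c y z -> z \in A) ->
  cluster s x c \subset A.
Proof.
move=> xA clA; apply/subsetP=> y; rewrite inE => /connectP[p].
move: clA; move: (alt s (s x) c) => r clA.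
elim: p x xA => [|z p IH] x xA /= => [_ ->//|/andP[xz zp] ylast].
exact: IH (clA _ _ xA xz) zp ylast.
Qed.

Lemma cluster_step s x c y z :
  y \in cluster s x c -> alt s (s x) c y z -> z \in cluster s x c.
Proof. by rewrite !inE => xy yz; apply: connect_trans xy (connect1 yz). Qed.

Lemma cluster_col s x c y : y \in cluster s x c -> (s y == s x) || (s y == c).
Proof.
have /subsetP H : cluster s x c \subset [set y | (s y == s x) || (s y == c)].
  by apply: cluster_min => [|a b _ /and4P[_ _ _]]; rewrite inE ?eqxx.
by move/H; rewrite inE.
Qed.

Definition mate s x c y := tperm (s x) c (s y).

Lemma mateP s x c y : y \in cluster s x c ->
  (s y = s x /\ mate s x c y = c) \/ (s y = c /\ mate s x c y = s x).
Proof.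
rewrite /mate => /cluster_col /orP[] /eqP ->; [left|right].
  by rewrite tpermL.
by rewrite tpermR.
Qed.

Lemma tperm_mate s x c y : y \in cluster s x c ->
  tperm (s y) (mate s x c y) = tperm (s x) c.
Proof. by case/mateP=> -[-> ->] //; rewrite tpermC. Qed.

Lemma alt_mate s x c y : y \in cluster s x c ->
  alt s (s y) (mate s x c y) =2 alt s (s x) c.
Proof. by case/mateP=> -[-> ->] // a b; rewrite altC. Qed.

Lemma cluster_mate s x c y : y \in cluster s x c ->
  cluster s y (mate s x c y) = cluster s x c.
Proof.
move=> yS; apply/setP=> z; rewrite [LHS]inE (eq_connect (alt_mate yS)).
by move: yS; rewrite !inE => xy; rewrite -(same_connect (@alt_csym s (s x) c) xy).
Qed.

Lemma flip_mate s x c y : y \in cluster s x c ->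
  flip s y (mate s x c y) = flip s x c.
Proof.
by move=> yS; apply/ffunP=> z; rewrite !ffunE cluster_mate // tperm_mate.
Qed.

Lemma mate_mate s x c y z : y \in cluster s x c -> z \in cluster s x c ->
  mate s y (mate s x c y) z = mate s x c z.
Proof. by move=> yS zS; rewrite {1}/mate tperm_mate. Qed.

Lemma mate_id s x c : mate s x c x = c.
Proof. by rewrite /mate tpermL. Qed.

Lemma flip_in s x c y : y \in cluster s x c -> flip s x c y = mate s x c y.
Proof. by move=> yS; rewrite ffunE yS. Qed.

Lemma flip_out s x c y : y \notin cluster s x c -> flip s x c y = s y.
Proof. by move=> yS; rewrite ffunE (negbTE yS). Qed.

Lemma flip_self s x : flip s x (s x) = s.
Proof. by apply/ffunP=> y; rewrite ffunE tperm1 perm1 if_same. Qed.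

Lemma cluster_self s x : cluster s x (s x) = [set x].
Proof.
apply/eqP; rewrite eqEsubset sub1set cluster_refl andbT.
apply: cluster_min => [|y z]; rewrite ?inE // => /eqP-> /and4P[_ + _].
by rewrite orbb eq_sym => /negbTE->.
Qed.

Definition agree v s t := forall x, x != v -> s x = t x.

Lemma flip_eq s x y c :
  cluster s x c = cluster s y c -> s x = s y -> flip s x c = flip s y c.
Proof. by move=> cE sE; rewrite /flip cE sE. Qed.

Lemma agree_sym v s t : agree v s t -> agree v t s.
Proof. by move=> st x /st. Qed.

Lemma alt_agree v s t c1 c2 x y : agree v s t -> x != v -> y != v ->
  alt s c1 c2 x y = alt t c1 c2 x y.
Proof. by move=> st xv yv; rewrite /alt !st. Qed.

Lemma cluster_avoid v s t x c : agree v s t -> v \notin cluster s x c ->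
  cluster s x c \subset cluster t x c.
Proof.
move=> st vS.
have nv y : y \in cluster s x c -> y != v by apply: contraTneq => ->.
suff: cluster s x c \subset cluster s x c :&: cluster t x c.
  by rewrite subsetI subxx.
apply: cluster_min => [|y z]; rewrite !in_setI ?cluster_refl //.
case/andP=> ys yt yz; have zs := cluster_step ys yz.
rewrite zs /=; apply: cluster_step yt _.
by rewrite -(alt_agree _ _ st) ?nv // -(st x) ?nv // cluster_refl.
Qed.

Lemma cluster_common v s t x c : agree v s t ->
  v \notin cluster s x c -> v \notin cluster t x c ->
  cluster s x c = cluster t x c.
Proof.
move=> st vs vt; apply/eqP; rewrite eqEsubset (cluster_avoid st) //.
by rewrite (cluster_avoid (agree_sym st)).
Qed.

Lemma cluster_attach v s t x c : agree v s t ->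
  v \notin cluster s x c -> v \in cluster t x c ->
  exists2 u, u \in cluster s x c & alt t (t x) c u v.
Proof.
move=> st vs vt; apply/exists_inP; case: (boolP [exists u in _, _]) => // /exists_inPn noatt.
have xs : x \in cluster s x c := cluster_refl _ _ _.
have nv y : y \in cluster s x c -> y != v by apply: contraTneq => ->.
suff /subsetP/(_ v vt) : cluster t x c \subset cluster s x c by rewrite (negbTE vs).
apply: cluster_min => [//|y z ys yz].
have zv : z != v by apply: contraTneq yz => ->; apply: noatt.
by apply: (cluster_step ys); rewrite (st x (nv _ xs)) (alt_agree _ _ st (nv _ ys) zv).
Qed.

Lemma cluster_cover v s t c : agree v s t -> c != s v ->
  cluster s v c \subset
  v |: \bigcup_(u | e v u && (s u == c)) cluster t u (s v).
Proof.
move=> st cv; apply: cluster_min => [|y z]; first by rewrite in_setU1 eqxx.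
move=> yA yz; rewrite in_setU1; case: (eqVneq z v) => //= zv.
case: (eqVneq y v) yA yz => [-> _|yv].
  case/and4P=> vz svz _ /orP[] szc.
    by rewrite eq_sym szc in svz.
  by apply/bigcupP; exists z; rewrite ?vz ?szc ?cluster_refl.
rewrite in_setU1 (negbTE yv) /= => /bigcupP[u /andP[vu /eqP suc] yu] yz.
apply/bigcupP; exists u; first by rewrite vu suc eqxx.
apply: cluster_step yu _; have uv : u != v by apply: contraNneq cv => <-; rewrite suc.
by rewrite -(alt_agree _ _ st) // -st // suc altC.
Qed.

Lemma cluster_nbr s v u c : e v u -> s u = c -> c != s v -> u \in cluster s v c.
Proof.
move=> vu suc cv; apply: cluster_step (cluster_refl _ _ _) _.
by rewrite /alt vu suc (eq_sym (s v)) cv !eqxx orbT.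
Qed.

Lemma cluster_nbr_eq s v u c : e v u -> s u = c -> c != s v ->
  cluster s u (s v) = cluster s v c.
Proof.
move=> vu suc cv; have := cluster_mate (cluster_nbr vu suc cv).
by rewrite /mate suc tpermR.
Qed.

End Clusters.

Lemma sum_frac (R : realFieldType) (I : finType) (cls : I -> {set I})
    (Q B : pred I) (G : I -> R) :
  (forall i, Q i -> i \in cls i) ->
  (forall i j, Q i -> j \in cls i -> [/\ Q j, cls j = cls i & G j = G i]) ->
  (forall i, Q i -> exists2 j, j \in cls i & B j) ->
  \sum_(i | Q i) G i / #|cls i|%:R =
  \sum_(j | Q j && B j) G j / #|[set l in cls j | B l]|%:R.
Proof.
move=> cls_refl cls_inv cls_B.
pose g i := G i / #|cls i|%:R / #|[set l in cls i | B l]|%:R.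
have nz0 (A : {set I}) (i : I) : i \in A -> #|A|%:R != 0 :> R.
  by move=> iA; rewrite pnatr_eq0 -lt0n; apply/card_gt0P; exists i.
transitivity (\sum_(i | Q i) \sum_(j | (j \in cls i) && B j) g i).
  apply: eq_bigr => i Qi; rewrite sumr_const -[RHS]mulr_natr -[in RHS]cardsE /g divfK //.
  have [j ji Bj] := cls_B _ Qi.
  by apply: (nz0 _ j); rewrite inE ji.
rewrite (exchange_big_dep (fun j => Q j && B j)) /=; last first.
  by move=> i j Qi /andP[ji Bj]; have [-> _ _] := cls_inv _ _ Qi ji.
apply: eq_bigr => j /andP[Qj Bj].
rewrite (eq_bigl (mem (cls j))) => [|i] /=; last first.
  rewrite Bj andbT; apply/andP/idP => [[Qi ji]|ij].
    by have [_ -> _] := cls_inv _ _ Qi ji; apply: cls_refl.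
  by have [Qi -> _] := cls_inv _ _ Qj ij; rewrite Qi cls_refl.
rewrite (eq_bigr (fun=> g j)) => [|i ij]; last first.
  by have [_ ei eG] := cls_inv _ _ Qj ij; rewrite /g ei eG.
rewrite sumr_const -[LHS]mulr_natr /g [LHS]mulrAC; congr (_ / _).
by rewrite divfK // (nz0 _ j) // cls_refl.
Qed.

Lemma sum_invol (R : nmodType) (I : finType) (P : pred I) (J : I -> I) (F : I -> R) :
  (forall i, P i -> P (J i)) -> (forall i, P i -> J (J i) = i) ->
  \sum_(i | P i) F (J i) = \sum_(i | P i) F i.
Proof.
move=> PJ JJ; rewrite [RHS](reindex_onto J J) //=.
apply: eq_bigl => i; apply/idP/andP => [Pi|[PJi /eqP <-]]; last exact: PJ.
by rewrite PJ // JJ.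
Qed.

(* A solution of the linear program given by the drift inequalities below at 1832/1000 instead
   of 11/6, up to the excess of [one_cost]; the value at 0 is irrelevant. *)
Definition flip_prob (R : realFieldType) (l : nat) : R :=
  match l with
  | 0 | 1 => 1 | 2 => 300 / 1000 | 3 => 166 / 1000 | 4 => 100 / 1000
  | 5 => 56 / 1000 | 6 => 23 / 1000 | _ => 0
  end.

Section Generator.
Variables (R : realFieldType) (T : finType) (e : rel T) (k : nat).
Hypothesis esym : symmetric e.
Notation col := {ffun T -> 'I_k}.
Notation cluster := (cluster e).
Notation flip := (flip e).
Implicit Types (s t : col) (c : 'I_k) (x y v : T).

Notation p := (flip_prob R).

Definition gen (F : col -> R) s : R :=
  \sum_(i : T * 'I_k) p #|cluster s i.1 i.2| / #|cluster s i.1 i.2|%:R *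
    (F (flip s i.1 i.2) - F s).

Definition mates s (i : T * 'I_k) : {set T * 'I_k} :=
  [set j | (j.1 \in cluster s i.1 i.2) && (j.2 == mate s i.1 i.2 j.1)].

Lemma mates_refl s i : i \in mates s i.
Proof. by rewrite inE cluster_refl mate_id eqxx. Qed.

Lemma card_mates s i : #|mates s i| = #|cluster s i.1 i.2|.
Proof.
rewrite -(card_imset (cluster s i.1 i.2) (f := fun y => (y, mate s i.1 i.2 y))).
  apply: eq_card => -[y c]; rewrite inE /=; apply/andP/imsetP => [[yS /eqP->]|[z zS [-> ->]]].
    by exists y.
  by rewrite zS eqxx.
by move=> y z [].
Qed.

Lemma matesE s i j : j \in mates s i ->
  [/\ cluster s j.1 j.2 = cluster s i.1 i.2, flip s j.1 j.2 = flip s i.1 i.2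
    & mates s j = mates s i].
Proof.
rewrite inE => /andP[jS /eqP jm].
have jE : cluster s j.1 j.2 = cluster s i.1 i.2 by rewrite jm cluster_mate.
split=> //; first by rewrite jm flip_mate.
apply/setP=> l; rewrite [LHS]inE [RHS]inE jE.
by case lS: (l.1 \in _); rewrite //= jm (mate_mate jS lS).
Qed.

Lemma sum_through s v (Phi : col -> R) :
  \sum_(i : T * 'I_k | v \in cluster s i.1 i.2)
    p #|cluster s i.1 i.2| / #|cluster s i.1 i.2|%:R * Phi (flip s i.1 i.2) =
  \sum_c p #|cluster s v c| * Phi (flip s v c).
Proof.
pose G (i : T * 'I_k) := p #|cluster s i.1 i.2| * Phi (flip s i.1 i.2).
pose Q (i : T * 'I_k) := v \in cluster s i.1 i.2.
transitivity (\sum_(i | Q i) G i / #|mates s i|%:R).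
  by apply: eq_bigr => i _; rewrite card_mates mulrAC.
rewrite (@sum_frac _ _ (mates s) Q (fun i => i.1 == v)); first last.
- move=> i Qi; exists (v, mate s i.1 i.2 v) => /=; last exact: eqxx.
  by rewrite inE /= eqxx andbT; exact: Qi.
- by move=> i j Qi /matesE [e1 e2 e3]; rewrite /Q /G e1 e2 e3; split.
- by move=> i _; apply: mates_refl.
rewrite (reindex_onto (fun c => (v, c)) snd) /=; last first.
  by case=> x c /= /andP[_ /eqP->].
apply: eq_big => [c|c _]; first by rewrite /Q cluster_refl !eqxx.
rewrite (_ : [set _ in _ | _] = [set (v, c)]) ?cards1 ?divr1 //.
apply/setP=> -[y c']; rewrite in_set1 xpair_eqE inE [_ \in mates _ _]inE /=.
by case: (eqVneq y v) => [->|]; rewrite ?cluster_refl ?mate_id ?andbT ?andbF.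
Qed.

Lemma sum_attached s t v (Phi : col -> R) : agree v s t ->
  \sum_(i : T * 'I_k | (v \notin cluster s i.1 i.2) && (v \in cluster t i.1 i.2))
    p #|cluster s i.1 i.2| / #|cluster s i.1 i.2|%:R * Phi (flip s i.1 i.2) =
  \sum_(u | [&& e v u, s u != t v & v \notin cluster s u (t v)])
    p #|cluster s u (t v)| /
      #|[set u' in cluster s u (t v) | e v u' && (s u' == s u)]|%:R *
    Phi (flip s u (t v)).
Proof.
move=> st.
pose G (i : T * 'I_k) := p #|cluster s i.1 i.2| * Phi (flip s i.1 i.2).
pose Q (i : T * 'I_k) := (v \notin cluster s i.1 i.2) && (v \in cluster t i.1 i.2).
have nv i x : v \notin cluster s i.1 i.2 -> x \in cluster s i.1 i.2 -> x != v.
  by move=> vS; apply: contraTneq => ->.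
transitivity (\sum_(i | Q i) G i / #|mates s i|%:R).
  by apply: eq_bigr => i _; rewrite card_mates mulrAC.
rewrite (@sum_frac _ _ (mates s) Q
  (fun i => [&& e v i.1, s i.1 != t v & i.2 == t v])); first last.
- move=> i /andP[vs vt]; have [u us /and4P[uv tuv tu tv]] := cluster_attach st vs vt.
  have ev : u != v by apply: nv us.
  exists (u, mate s i.1 i.2 u); first by rewrite inE us eqxx.
  rewrite /= esym uv (st u) // tuv /=; move: tuv tv.
  rewrite -(st u) // -(st i.1); last by rewrite (nv i) ?cluster_refl.
  by case/mateP: us => -[-> ->] suv /orP[] /eqP tE; rewrite ?tE ?eqxx // tE eqxx in suv *.
- move=> i j /andP[vs vt] ji; have [e1 e2 e3] := matesE ji.
  rewrite /Q /G e1 e2 e3; split=> //; rewrite vs /=.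
  have: cluster t j.1 j.2 = cluster t i.1 i.2; last by move->.
  move: ji; rewrite inE => /andP[js /eqP->].
  have jt := subsetP (cluster_avoid st vs) _ js.
  have -> : mate s i.1 i.2 j.1 = mate t i.1 i.2 j.1.
    by rewrite /mate !st ?(nv i) ?cluster_refl.
  by rewrite cluster_mate.
- by move=> i _; apply: mates_refl.
rewrite (reindex_onto (fun u => (u, t v)) fst) /=; last first.
  by case=> x c /= /andP[_ /and3P[_ _ /eqP->]].
apply: eq_big => [u|u].
  rewrite !eqxx !andbT /Q /=; case: (boolP (e v u)); rewrite ?andbF //= => vu.
  case: (boolP (s u != t v)); rewrite ?andbF //= => suv; rewrite !andbT.
  case: (boolP (v \notin _)) => //= vs.
  have uv : u != v by rewrite (nv (u, t v)) ?cluster_refl.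
  have alt_uv : alt e t (t u) (t v) u v.
    by rewrite /alt esym vu -(st u) // suv !eqxx orbT.
  by rewrite (cluster_step (cluster_refl _ _ _ _) alt_uv).
rewrite !eqxx !andbT => /and3P[/andP[/= vs _] vu suv]; rewrite /G /= mulrAC.
congr (_ / _ * _); rewrite -(card_imset _ (f := fun y => (y, t v))); last by move=> ? ? [].
congr (_%:R); apply: eq_card => -[y c]; rewrite inE [_ \in mates _ _]inE /=.
apply/andP/imsetP => [[/andP[yS /eqP cE] /and3P[vy syv /eqP cv]]|].
  exists y; rewrite ?cv // inE yS vy /=; move: syv.
  by case/mateP: (yS) => -[-> E]; rewrite ?eqxx // -cv cE E eqxx.
case=> z; rewrite inE => /and3P[zS vz /eqP szu] [-> ->].
by rewrite zS vz szu suv eqxx /mate szu tpermL eqxx.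
Qed.

Lemma gen_split s t v F : agree v s t ->
  gen F s =
  \sum_(i : T * 'I_k | (v \notin cluster s i.1 i.2) && (v \notin cluster t i.1 i.2))
    p #|cluster s i.1 i.2| / #|cluster s i.1 i.2|%:R * (F (flip s i.1 i.2) - F s)
  + \sum_c p #|cluster s v c| * (F (flip s v c) - F s)
  + \sum_(u | [&& e v u, s u != t v & v \notin cluster s u (t v)])
    p #|cluster s u (t v)| /
      #|[set u' in cluster s u (t v) | e v u' && (s u' == s u)]|%:R *
    (F (flip s u (t v)) - F s).
Proof.
move=> st; rewrite -(sum_attached (fun s' => F s' - F s) st).
rewrite -(sum_through s v (fun s' => F s' - F s)).
rewrite /gen (bigID (fun i => v \in cluster s i.1 i.2)) /=.
rewrite (bigID (fun i => v \in cluster t i.1 i.2) (fun i => v \notin cluster s i.1 i.2)) /=.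
by rewrite addrC -addrA addrC.
Qed.

End Generator.

Section FlipProb.
Variable R : realFieldType.
Notation p := (flip_prob R).

Lemma flip_prob_large l : (7 <= l)%N -> p l = 0.
Proof. by do 7 (case: l => // l). Qed.

Lemma flip_prob_ge0 l : 0 <= p l.
Proof. by do 7 (case: l => [|l] /=; first by lra). Qed.

Lemma flip_prob_le1 l : p l <= 1.
Proof. by do 7 (case: l => [|l] /=; first by lra); lra. Qed.

Lemma flip_probS l : p l.+1 <= p l.
Proof. by do 7 (case: l => [|l] /=; first by lra). Qed.

Lemma flip_prob_mono a b : (a <= b)%N -> p b <= p a.
Proof.
by move/subnK <-; elim: (b - a)%N => // n; apply: le_trans; rewrite addSn flip_probS.
Qed.

Lemma mul_flip_prob_le1 l : l%:R * p l <= 1.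
Proof.
by do 7 (case: l => [|l] /=; first by rewrite ?mulr0n ?mulr1n; lra); rewrite mulr0 ler01.
Qed.

Lemma mul1_flip_prob_le l : (0 < l)%N -> (l%:R - 1) * p l <= 332 / 1000.
Proof.
case: l => // l _.
by do 6 (case: l => [|l] /=; first by rewrite ?mulr0n ?mulr1n; lra); rewrite mulr0; lra.
Qed.

Lemma mul2_flip_prob_le l : (1 < l)%N -> (l%:R - 2) * p l <= 2 / 10.
Proof.
case: l => [|[|l]] // _.
by do 5 (case: l => [|l] /=; first by rewrite ?mulr0n ?mulr1n; lra); rewrite mulr0; lra.
Qed.

Lemma mul_flip_prob_le4 l : (4 <= l)%N -> l%:R * p l <= 4 / 10.
Proof.
do 4 (case: l => // l); move=> _.
by do 3 (case: l => [|l] /=; first by lra); rewrite mulr0; lra.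
Qed.

Lemma flip_prob_diff l : (0 < l)%N -> l%:R * (p l - p l.+1) <= 7 / 10.
Proof.
case: l => // l _.
by do 6 (case: l => [|l] /=; first by lra); rewrite subrr mulr0; lra.
Qed.

Lemma flip_prob_diff2 l : (1 < l)%N -> l%:R * (p l - p l.+1) <= 268 / 1000.
Proof.
case: l => [|[|l]] // _.
by do 5 (case: l => [|l] /=; first by lra); rewrite subrr mulr0; lra.
Qed.

Lemma flip_prob_diff3 l : (0 < l)%N -> l != 2 ->
  (l%:R - 1) * (p l - p l.+1) <= 132 / 1000.
Proof.
case: l => [|[|[|l]]] // _ _; first by rewrite /=; lra.
by do 4 (case: l => [|l] /=; first by lra); rewrite subrr mulr0; lra.
Qed.

Lemma flip_prob_diff1 l : (0 < l)%N -> (l%:R - 1) * (p l - p l.+1) <= 134 / 1000.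
Proof.
case: (eqVneq l 2) => [->|l2] l0; first by rewrite /=; lra.
by have := flip_prob_diff3 l0 l2; lra.
Qed.

Lemma flip_prob_diff_merge l : (0 < l)%N ->
  l%:R * (p l - p l.+1) - p l.+1 <= 4 / 10.
Proof.
case: l => // l _.
by do 6 (case: l => [|l] /=; first by lra); rewrite subrr mulr0; lra.
Qed.

(* Half of the drift of a colour seen twice around [v], with cluster sizes [b <= a]; [x] and [y]
   tell on which side the joint flip of the two clusters at a neighbour is credited. *)
Definition two_cost (x y : bool) (a b : nat) : R :=
  (a%:R - x%:R) * (p a - p (a + b).+1) + (b%:R - y%:R) * p b + b%:R * p (a + b).+1
  + 9 / 100 * ((x && (a == 1%N))%:R + (y && (b == 1%N))%:R).

Lemma two_cost00 a b : (0 < b <= a)%N -> two_cost false false a b <= 2.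
Proof.
move=> /andP[b0 ba]; have ba' : b%:R <= a%:R :> R by rewrite ler_nat.
have := mul_flip_prob_le1 a; have := mul_flip_prob_le1 b.
have : 0 <= (a%:R - b%:R) * p (a + b).+1 by rewrite mulr_ge0 ?flip_prob_ge0 ?subr_ge0.
rewrite /two_cost; move: (p a) (p b) (p _.+1) => pa pb pc.
by rewrite !mulr0n; lra.
Qed.

Lemma two_cost_le a b : (0 < b <= a)%N ->
  [/\ two_cost true false a b <= 13 / 10, two_cost false true a b <= 13 / 10
    & two_cost true true a b <= 664 / 1000].
Proof.
case/andP=> b0 ba; have [a7|] := leqP 7 a.
  have pb1 := mul_flip_prob_le1 b; have pb2 := mul1_flip_prob_le b0.
  have g0 : (b == 1%N)%:R <= 1 :> R by case: eqP => _; rewrite ?mulr1n ?mulr0n ?ler01 ?lexx.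
  rewrite /two_cost (flip_prob_large a7) (@flip_prob_large (a + b).+1); last by lia.
  have -> : a == 1%N = false by lia.
  by move: (p b) pb1 pb2 g0 => pb; rewrite /= !mulr0n !mulr1n; split; lra.
case: a ba => [|[|[|[|[|[|[|a]]]]]]] // ba _;
  case: b b0 ba => [|[|[|[|[|[|[|b]]]]]]] // _ _;
  by rewrite /two_cost /= ?mulr0n ?mulr1n; split; lra.
Qed.
End FlipProb.

(** * Drift of one colour around a single disagreement *)

Section Geometry.
Variables (R : realFieldType) (T : finType) (e : rel T) (k : nat).
Hypotheses (esym : symmetric e) (eirr : irreflexive e).
Notation col := {ffun T -> 'I_k}.
Notation cluster := (cluster e).
Notation flip := (flip e).
Notation p := (flip_prob R).
Implicit Types (s t : col) (c : 'I_k) (x y v u : T) (F : col -> R).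

Definition hamming_lip F := forall (W : {set T}) s t,
  (forall x, x \notin W -> s x = t x) -> F s - F t <= #|W|%:R.

Lemma hlipN F : hamming_lip F -> hamming_lip (fun s => - F s).
Proof. by move=> HF W s t st; rewrite opprK addrC HF // => x /st. Qed.

Definition nbrs s v c := [set u | e v u && (s u == c)].

(* The part of the generator at [s] involving the clusters of [v] and colour [c]. The second sum is
   over clusters of [t] that [v] glues together in [s]; dividing by the number of neighbours of
   [v] they contain counts each of them once. *)
Definition vdrift F s t v c : R :=
  p #|cluster s v c| * (F (flip s v c) - F s) -
  \sum_(u | [&& e v u, t u == c, c != s v & v \notin cluster t u (s v)])
    p #|cluster t u (s v)| /
      #|[set u' in cluster t u (s v) | e v u' && (t u' == t u)]|%:R *
    (F (flip t u (s v)) - F t).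

Lemma gen_diff F s t v : agree v s t ->
  gen e F s - gen e F t =
  \sum_(i : T * 'I_k | (v \notin cluster s i.1 i.2) && (v \notin cluster t i.1 i.2))
    p #|cluster s i.1 i.2| / #|cluster s i.1 i.2|%:R *
    ((F (flip s i.1 i.2) - F s) - (F (flip t i.1 i.2) - F t))
  + \sum_c (vdrift F s t v c - vdrift F t s v c).
Proof.
move=> st; have ts := agree_sym st.
rewrite (gen_split esym F st) (gen_split esym F ts).
pose q s t u := p #|cluster s u (t v)| /
      #|[set u' in cluster s u (t v) | e v u' && (s u' == s u)]|%:R *
    (F (flip s u (t v)) - F s).
have group s' t' : \sum_(u | [&& e v u, s' u != t' v & v \notin cluster s' u (t' v)])
    q s' t' u = \sum_c \sum_(u | [&& e v u, s' u == c, c != t' v & v \notin cluster s' u (t' v)])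
    q s' t' u.
  rewrite (partition_big (fun u => s' u) predT) //=; apply: eq_bigr => c _.
  by apply: eq_bigl => u; case: (eqVneq (s' u) c) => [->|]; rewrite ?andbF ?andbT.
rewrite -/(q s t) -/(q t s) !group /vdrift sumrB !sumrB.
have aux (x y z x' y' z' : R) :
  x + y + z - (x' + y' + z') = (x - x') + ((y - z') - (y' - z)) by ring.
rewrite aux; congr (_ + _).
rewrite [X in _ - X](eq_bigl (fun i : T * 'I_k =>
  (v \notin cluster s i.1 i.2) && (v \notin cluster t i.1 i.2))); last first.
  by move=> i; rewrite andbC.
rewrite -sumrB; apply: eq_bigr => i /andP[vs vt].
by rewrite -(cluster_common st vs vt) -mulrBr.
Qed.

Lemma nbrs_agree s t v c : agree v s t -> nbrs s v c = nbrs t v c.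
Proof.
move=> st; apply/setP=> u; rewrite !inE; case: (boolP (e v u)) => //= vu.
by rewrite st //; apply: contraTneq vu => ->; rewrite eirr.
Qed.

Section Pair.
Variables (F : col -> R) (s t : col) (v : T) (c : 'I_k).
Hypotheses (HF : hamming_lip F) (st : agree v s t).

Lemma flip_dist x d : F (flip s x d) - F s <= #|cluster s x d|%:R.
Proof. by apply: HF => y /flip_out. Qed.

Lemma flip_dist_rev x d : F s - F (flip s x d) <= #|cluster s x d|%:R.
Proof. by apply: HF => y /flip_out ->. Qed.

Lemma nbr_neq u : u \in nbrs s v c -> u != v.
Proof. by rewrite inE => /andP[vu _]; apply: contraTneq vu => ->; rewrite eirr. Qed.

Lemma nbr_col u : u \in nbrs s v c -> t u = c.
Proof. by move=> uN; rewrite -st ?nbr_neq //; move: uN; rewrite inE => /andP[_ /eqP]. Qed.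

Hypothesis csv : c != s v.

Lemma nbr_cluster u : u \in nbrs s v c -> u \in cluster s v c.
Proof. by rewrite inE => /andP[vu /eqP suc]; apply: cluster_nbr. Qed.

Lemma cluster_nbr_sub u : u \in nbrs s v c -> v \notin cluster t u (s v) ->
  cluster t u (s v) \subset cluster s v c.
Proof.
move=> uN vt; have := cluster_avoid (agree_sym st) vt.
by move: uN; rewrite inE => /andP[vu /eqP suc]; rewrite (cluster_nbr_eq _ vu suc).
Qed.

Lemma flip_joint u x : u \in nbrs s v c -> v \notin cluster t u (s v) ->
  x \notin cluster s v c :\: cluster t u (s v) -> flip s v c x = flip t u (s v) x.
Proof.
move=> uN vt; rewrite inE negb_and negbK => xW.
have sub := subsetP (cluster_nbr_sub uN vt) x.
case: (boolP (x \in cluster t u (s v))) xW sub => [xt _ /(_ isT) xs|xt /= xs _].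
  rewrite !flip_in // /mate (nbr_col uN) tpermC (st (x := x)) //.
  by apply: contraTneq xt => ->.
rewrite !flip_out // st //; apply: contraNneq xs => ->; exact: cluster_refl.
Qed.

Lemma joint_dist u : u \in nbrs s v c -> v \notin cluster t u (s v) ->
  F (flip s v c) - F (flip t u (s v)) <= #|cluster s v c|%:R - #|cluster t u (s v)|%:R
  /\ F (flip t u (s v)) - F (flip s v c) <= #|cluster s v c|%:R - #|cluster t u (s v)|%:R.
Proof.
move=> uN vt; have sub := cluster_nbr_sub uN vt.
rewrite -natrB ?subset_leq_card // -cardsDS //; split; apply: HF => x xW.
  exact: flip_joint.
by rewrite (flip_joint uN vt xW).
Qed.

Lemma cluster_coverN :
  cluster s v c \subset v |: \bigcup_(u in nbrs s v c) cluster t u (s v).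
Proof.
have := cluster_cover e st csv; congr (_ \subset _ |: _).
by apply: eq_bigl => u; rewrite inE.
Qed.

Lemma card_cluster_nbrs : (#|nbrs s v c| < #|cluster s v c|)%N.
Proof.
have vN : v \notin nbrs s v c by rewrite inE eirr.
have <- : #|v |: nbrs s v c| = #|nbrs s v c|.+1 by rewrite cardsU1 vN.
apply: subset_leq_card; apply/subsetP=> x; rewrite in_setU1 => /orP[/eqP->|].
  exact: cluster_refl.
exact: nbr_cluster.
Qed.

Lemma card_cluster0 : nbrs s v c = set0 -> #|cluster s v c| = 1%N.
Proof.
move=> N0; apply/eqP; rewrite eqn_leq; apply/andP; split; last first.
  by have := card_cluster_nbrs; case: #|cluster _ _ _|.
have := subset_leq_card cluster_coverN; rewrite N0 big_set0 setU0 cards1 //.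
Qed.

Lemma card_cluster1 u : nbrs s v c = [set u] -> v \notin cluster t u (s v) ->
  #|cluster s v c| = #|cluster t u (s v)|.+1.
Proof.
move=> N1 vt; have uN : u \in nbrs s v c by rewrite N1 set11.
have -> : cluster s v c = v |: cluster t u (s v); last by rewrite cardsU1 vt.
apply/eqP; rewrite eqEsubset subUset sub1set cluster_refl cluster_nbr_sub // andbT.
by have := cluster_coverN; rewrite N1 big_set1 => ->.
Qed.

Lemma nbr_clusters_eq u1 u2 x : u1 \in nbrs s v c -> u2 \in nbrs s v c ->
  x \in cluster t u1 (s v) -> x \in cluster t u2 (s v) ->
  cluster t u1 (s v) = cluster t u2 (s v).
Proof.
move=> /nbr_col u1c /nbr_col u2c; rewrite !inE u1c u2c => x1 x2.
have csym := @alt_csym _ _ _ esym t c (s v).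
apply/setP=> z; rewrite !inE u1c u2c (same_connect csym x1).
by rewrite (same_connect csym x2).
Qed.

Lemma card_cluster2 u1 u2 : nbrs s v c = [set u1; u2] ->
  v \notin cluster t u1 (s v) -> v \notin cluster t u2 (s v) ->
  u2 \notin cluster t u1 (s v) ->
  #|cluster s v c| = (#|cluster t u1 (s v)| + #|cluster t u2 (s v)|).+1.
Proof.
move=> N2 vt1 vt2 u21.
have u1N : u1 \in nbrs s v c by rewrite N2 !inE eqxx.
have u2N : u2 \in nbrs s v c by rewrite N2 !inE eqxx orbT.
have -> : cluster s v c = v |: (cluster t u1 (s v) :|: cluster t u2 (s v)).
  apply/eqP; rewrite eqEsubset !subUset sub1set cluster_refl !cluster_nbr_sub // andbT.
  by have := cluster_coverN; rewrite N2 bigcup_setU !big_set1 => ->.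
rewrite cardsU1 in_setU negb_or vt1 vt2 cardsU; congr (_.+1).
rewrite (_ : _ :&: _ = set0) ?cards0 ?subn0 //.
apply/setP=> x; rewrite !inE -[RHS]/false; apply/negP => /andP[].
rewrite -!in_set -/(cluster t u1 (s v)) -/(cluster t u2 (s v)) => x1 x2.
by case/negP: u21; rewrite (nbr_clusters_eq u1N u2N x1 x2) cluster_refl.
Qed.

Lemma card_cluster_same u1 u2 : nbrs s v c = [set u1; u2] ->
  v \notin cluster t u1 (s v) -> u2 \in cluster t u1 (s v) ->
  #|cluster s v c| = #|cluster t u1 (s v)|.+1.
Proof.
move=> N2 vt1 u21.
have u1N : u1 \in nbrs s v c by rewrite N2 !inE eqxx.
have u2N : u2 \in nbrs s v c by rewrite N2 !inE eqxx orbT.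
have -> : cluster s v c = v |: cluster t u1 (s v); last by rewrite cardsU1 vt1.
apply/eqP; rewrite eqEsubset subUset sub1set cluster_refl cluster_nbr_sub //= ?andbT.
have := cluster_coverN; rewrite N2 bigcup_setU !big_set1.
by rewrite -(nbr_clusters_eq u1N u2N u21) ?cluster_refl // setUid => ->.
Qed.

Definition blockers s' t' v' u :=
  #|[set w | [&& e u w, w != v' & (s' w == s' v') || (s' w == t' v')]]|.

End Pair.

Section TwoSided.
Variables (F : col -> R) (s t : col) (v : T) (c : 'I_k).
Hypotheses (HF : hamming_lip F) (st : agree v s t) (csv : c != s v) (ctv : c != t v).
Hypothesis stv : s v != t v.

Let ts := agree_sym st.

Lemma nbr_out u : u \in nbrs s v c -> v \notin cluster t u (s v).
Proof.
move=> uN; apply/negP => /cluster_col; rewrite (nbr_col st uN).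
by rewrite eq_sym (negbTE ctv) eq_sym (negbTE stv).
Qed.

Lemma blk_le u : u \in nbrs s v c ->
  ((blockers s t v u).+2 <= #|cluster t u (s v)| + #|cluster s u (t v)|)%N.
Proof.
move=> uN; have uc := nbr_col st uN.
have us : s u = c by move: uN; rewrite inE => /andP[_ /eqP].
have sub : [set w | [&& e u w, w != v & (s w == s v) || (s w == t v)]] \subset
   (cluster t u (s v) :\ u) :|: (cluster s u (t v) :\ u).
  apply/subsetP=> w; rewrite inE => /and3P[uw wv swc].
  have wu : w != u by apply: contraTneq uw => ->; rewrite eirr.
  rewrite in_setU !in_setD1 wu /=; apply/orP.
  case/orP: swc => /eqP sw; [left|right].
    by apply: cluster_nbr; rewrite // ?uc 1?eq_sym // -st.
  by apply: cluster_nbr; rewrite // ?us 1?eq_sym.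
have := subset_leq_card sub; rewrite -/(blockers s t v u).
have := (leq_card_setU (cluster t u (s v) :\ u) (cluster s u (t v) :\ u)).1.
have := cardsD1 u (cluster t u (s v)); have := cardsD1 u (cluster s u (t v)).
rewrite !cluster_refl; lia.
Qed.

Lemma blk0 u : u \in nbrs s v c -> blockers s t v u = 0%N ->
  #|cluster t u (s v)| = 1%N /\ #|cluster s u (t v)| = 1%N.
Proof.
move=> uN /eqP; rewrite cards_eq0 => /eqP b0.
have uv := nbr_neq uN.
have uc := nbr_col st uN.
have us : s u = c by move: uN; rewrite inE => /andP[_ /eqP].
have nob w : e u w -> w != v -> (s w != s v) && (s w != t v).
  move=> uw wv; have := in_set0 w; rewrite -b0 inE uw wv /= => /negbT.
  by rewrite negb_or.
split.
  rewrite (_ : cluster t u (s v) = [set u]) ?cards1 //; apply/eqP.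
  rewrite eqEsubset sub1set cluster_refl andbT.
  apply: cluster_min => [|y z]; rewrite !in_set1 // => /eqP -> /and4P[uz tuz _].
  rewrite eq_sym (negbTE tuz) /=; case: (eqVneq z v) => [->|zv].
    by rewrite eq_sym (negbTE stv).
  by rewrite -(st zv); case/andP: (nob z uz zv) => /negbTE ->.
rewrite (_ : cluster s u (t v) = [set u]) ?cards1 //; apply/eqP.
rewrite eqEsubset sub1set cluster_refl andbT.
apply: cluster_min => [|y z]; rewrite !in_set1 // => /eqP -> /and4P[uz tuz _].
rewrite eq_sym (negbTE tuz) /=; case: (eqVneq z v) => [->|zv].
  by rewrite (negbTE stv).
by case/andP: (nob z uz zv) => _ /negbTE ->.
Qed.

Lemma both_dist u : u \in nbrs s v c ->
  F (flip s u (t v)) - F (flip t u (s v)) <=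
  #|cluster t u (s v)|%:R + #|cluster s u (t v)|%:R.
Proof.
move=> uN; pose W := v |: (cluster t u (s v) :|: (cluster s u (t v) :\ u)).
apply: (le_trans (HF (W := W) _)) => [x|].
  rewrite !in_setU1 !negb_or in_setU in_setD1 negb_or => /and3P[xv xt xs].
  rewrite [RHS]flip_out // flip_out ?st //; apply: contra xs => ->.
  by rewrite andbT; apply: contraNneq xt => ->; rewrite cluster_refl.
rewrite -natrD ler_nat /W cardsU1 (leq_trans (leq_add (leq_b1 _) (leq_card_setU _ _).1)) //.
have := cardsD1 u (cluster s u (t v)); rewrite cluster_refl; lia.
Qed.

Lemma flips_dist :
  F (flip s v c) - F (flip t v c) <=
  #|cluster s v c|%:R + #|cluster t v c|%:R - #|nbrs s v c|%:R - 2.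
Proof.
pose W := (cluster s v c :|: cluster t v c) :\ v.
have vW : v \in cluster s v c :|: cluster t v c by rewrite in_setU cluster_refl.
apply: (le_trans (HF (W := W) _)) => [x|].
  rewrite in_setD1 in_setU negb_and negbK => /orP[/eqP->|].
    by rewrite !flip_in ?cluster_refl // !mate_id.
  rewrite negb_or => /andP[xs xt]; rewrite !flip_out // st //.
  by apply: contraNneq xs => ->; apply: cluster_refl.
have sub : v |: nbrs s v c \subset cluster s v c :&: cluster t v c.
  apply/subsetP=> x; rewrite in_setU1 in_setI => /orP[/eqP->|xN].
    by rewrite !cluster_refl.
  by rewrite nbr_cluster // nbr_cluster // -(nbrs_agree _ st).
have := subset_leq_card sub; rewrite cardsU1 inE eirr /=.
have := cardsUI (cluster s v c) (cluster t v c).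
have := cardsD1 v (cluster s v c :|: cluster t v c); rewrite vW -/W.
move=> e1 e2 e3.
have: (#|W| + #|nbrs s v c| + 2 <= #|cluster s v c| + #|cluster t v c|)%N by lia.
rewrite -(ler_nat R) !natrD; lra.
Qed.

End TwoSided.
End Geometry.

Section Costs.
Variable R : realFieldType.
Notation p := (flip_prob R).

Lemma pair_cost (q q' a b z1 z2 h : R) :
  0 <= q <= 1 -> 0 <= q' <= 1 -> 0 <= h -> z1 <= a -> z2 <= b ->
  z2 + z1 <= a + b - 1 + h ->
  exists x : bool, q * z1 + q' * z2 <= (a - x%:R) * q + (b - (~~ x)%:R) * q' + h.
Proof.
move=> /andP[q0 q1] /andP[r0 r1] h0 za zb zab; have [qq|/ltW qq] := leP q q'.
  exists true; rewrite /= mulr1n mulr0n; nra.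
by exists false; rewrite /= mulr1n mulr0n; nra.
Qed.

Lemma one_cost (n a b : nat) : (0 < a)%N -> (0 < b)%N -> (n.+2 <= a + b)%N ->
  (n = 0%N -> a = 1%N /\ b = 1%N) ->
  (a%:R - 1) * (p a - p a.+1) + b%:R * (p b - p b.+1) <=
  832 / 1000 - 9 / 100 * (n == 0%N)%:R + 25 / 10000 * (n == 1%N)%:R.
Proof.
move=> a0 b0 nab n0.
have qa := flip_prob_diff1 R a0; have qb := flip_prob_diff R b0.
have [b2|] := ltnP 1 b.
  have qb2 := flip_prob_diff2 R b2.
  have -> : n == 0%N = false by apply/eqP => /n0 [_ bE]; rewrite bE in b2.
  have : 0 <= (n == 1%N)%:R :> R by rewrite ler0n.
  by rewrite mulr0n; lra.
move=> b1; have {b1} bE : b = 1%N by lia.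
have [a1|a1] := eqVneq a 1%N.
  have nE : n = 0%N by lia.
  rewrite a1 bE nE /= mulr1n mulr0n; lra.
have nN : n == 0%N = false by apply/eqP => /n0 [aE _]; rewrite aE in a1.
have [a2|a2] := eqVneq a 2%N.
  have nE : n = 1%N by move: nN nab; rewrite a2 bE; case: n {n0} => [|[|]].
  rewrite a2 bE nE /= mulr1n mulr0n; lra.
have qa3 := flip_prob_diff3 R a0 a2; rewrite nN mulr0n.
have : 0 <= (n == 1%N)%:R :> R by rewrite ler0n.
by lra.
Qed.

Definition two_bound (x y : bool) : R :=
  if x && y then 664 / 1000 else if x || y then 13 / 10 else 2.

Lemma two_boundE x y : two_bound x y + two_bound (~~ x) (~~ y) <= 2664 / 1000.
Proof. by case: x y => -[]; rewrite /two_bound /=; lra. Qed.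

Lemma two_cost_bound x y a b : (0 < b <= a)%N -> two_cost R x y a b <= two_bound x y.
Proof.
move=> ab; have [H1 H2 H3] := two_cost_le R ab.
by case: x; case: y => //; rewrite /two_bound /=; apply: two_cost00.
Qed.

Lemma side_two (a1 a2 : nat) (X z1 z2 h : R) : (0 < a1)%N -> (0 < a2)%N -> 0 <= h ->
  X - z1 <= a2%:R + h -> X - z2 <= a1%:R + h ->
  exists q1 q2 d : R,
  [/\ 0 <= q1 <= 1, 0 <= q2 <= 1,
      p (a1 + a2).+1 * X - (p a1 * z1 + p a2 * z2) <= d + h + (q1 * - z1 + q2 * - z2) &
      forall x y : bool, (a1%:R - x%:R) * q1 + (a2%:R - y%:R) * q2 + d +
        9 / 100 * ((x && (a1 == 1%N))%:R + (y && (a2 == 1%N))%:R) <= two_bound x y].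
Proof.
move=> a10 a20 h0 X1 X2; set A := (a1 + a2).+1.
have A0 := flip_prob_ge0 R A; have A1 := flip_prob_le1 R A.
have pa1 : p A <= p a1 by apply: flip_prob_mono; rewrite /A; lia.
have pa2 : p A <= p a2 by apply: flip_prob_mono; rewrite /A; lia.
have l1 := flip_prob_le1 R a1; have l2 := flip_prob_le1 R a2.
case: (leqP a2 a1) => [a21|/ltnW a12].
  exists (p a1 - p A), (p a2), (a2%:R * p A); split; try by apply/andP; split; lra.
    by nra.
  move=> x y; have := @two_cost_bound x y a1 a2; rewrite a20 a21 => /(_ isT).
  by rewrite /two_cost -/A; lra.
exists (p a1), (p a2 - p A), (a1%:R * p A); split; try by apply/andP; split; lra.
  by nra.
move=> x y; have := @two_cost_bound y x a2 a1; rewrite a10 a12 => /(_ isT).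
rewrite /two_cost (addnC a2) -/A => H.
have -> : two_bound x y = two_bound y x by rewrite /two_bound andbC orbC.
by lra.
Qed.

Lemma ge0_div_le (x : R) n : 0 <= x -> (0 < n)%N -> 0 <= x / n%:R <= x.
Proof.
move=> x0 n0; rewrite divr_ge0 ?ler0n //= ler_pdivrMr ?ltr0n // ler_peMr // ler1n //.
Qed.

End Costs.

Section MergingColor.
Variables (R : realFieldType) (T : finType) (e : rel T) (k : nat).
Hypotheses (esym : symmetric e) (eirr : irreflexive e).
Notation col := {ffun T -> 'I_k}.
Notation cluster := (cluster e).
Notation flip := (flip e).
Notation p := (flip_prob R).
Notation nbrs := (nbrs e).

Implicit Types (s t : col) (c : 'I_k) (x y v u : T) (F : col -> R).

Lemma vdriftN F s t v c : vdrift e (fun s => - F s) s t v c = - vdrift e F s t v c.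
Proof.
rewrite /vdrift opprB addrC -sumrN; congr (_ + _).
  by apply: eq_bigr => u _; ring.
by ring.
Qed.

Definition fshare t v u c' : R := p #|cluster t u c'| /
  #|[set u' in cluster t u c' | e v u' && (t u' == t u)]|%:R.

Lemma fshareP t v u c' : e v u -> 0 <= fshare t v u c' <= p #|cluster t u c'|.
Proof.
move=> vu; apply: ge0_div_le; first exact: flip_prob_ge0.
by apply/card_gt0P; exists u; rewrite inE cluster_refl vu eqxx.
Qed.

Lemma fshare_cost F t v u c' : hamming_lip F -> e v u ->
  - (fshare t v u c' * (F (flip t u c') - F t)) <= 1.
Proof.
move=> HF vu; have /andP[f0 f1] := fshareP t c' vu.
have d := flip_dist_rev e t HF u c'.
have c0 : 0 <= #|cluster t u c'|%:R :> R by rewrite ler0n.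
have := mul_flip_prob_le1 R #|cluster t u c'|; nra.
Qed.

Lemma vdrift_merge F s t v : hamming_lip F -> agree v s t -> s v != t v -> 0 <= 1 - (F s - F t) ->
  vdrift e F s t v (t v) <=
  1742 / 1000 * #|nbrs s v (t v)|%:R - 1 + (1 - (F s - F t)).
Proof.
move=> HF st stv; have csv : t v != s v by rewrite eq_sym.
set h := 1 - _ => h0; set c := t v; set A := #|cluster s v c|.
have X1 : F (flip s v c) - F s <= A%:R - 2 + h.
  suff : F (flip s v c) - F t <= A%:R - 1 by rewrite /h; lra.
  have -> : A%:R - 1 = #|cluster s v c :\ v|%:R :> R.
    by rewrite /A (cardsD1 v) cluster_refl add1n -natr1 addrK.
  apply: HF => x; rewrite in_setD1 negb_and negbK => /orP[/eqP->|xs].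
    by rewrite flip_in ?cluster_refl // mate_id.
  by rewrite flip_out // st //; apply: contraNneq xs => ->; apply: cluster_refl.
have pA0 := flip_prob_ge0 R A; have pA1 := flip_prob_le1 R A.
have mA := card_cluster_nbrs eirr csv.
have m_lt : (#|nbrs s v c| < A)%N by [].
have sumE : vdrift e F s t v c = p A * (F (flip s v c) - F s) -
  \sum_(u in [set u in nbrs s v c | v \notin cluster t u (s v)])
     fshare t v u (s v) * (F (flip t u (s v)) - F t).
  congr (_ - _); apply: eq_bigl => u; rewrite !inE csv /=.
  case: (boolP (e v u)) => //= vu.
  by rewrite (st u) //; apply: contraTneq vu => ->; rewrite eirr.
have [m2|] := ltnP 1 #|nbrs s v c|.
  have A2 : (1 < A)%N by lia.
  have := mul2_flip_prob_le R A2.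
  have S1 : vdrift e F s t v c <= p A * (F (flip s v c) - F s) + #|nbrs s v c|%:R.
    rewrite sumE lerD2l -sumrN.
    apply: (@le_trans _ _ (\sum_(u in [set u in nbrs s v c | v \notin cluster t u (s v)]) 1)).
      by apply: ler_sum => u; rewrite !inE => /andP[/andP[vu _] _]; apply: fshare_cost.
    rewrite sumr_const ler_nat; apply/subset_leq_card/subsetP => u.
    by rewrite inE => /andP[].
  have : 2 <= #|nbrs s v c|%:R :> R by rewrite ler_nat.
  by nra.
rewrite leq_eqVlt ltnS leqn0 => /orP[/cards1P[u N1]|/eqP/cards0_eq N0]; last first.
  have A1 : A = 1%N by rewrite /A (card_cluster0 eirr st csv).
  rewrite sumE N0 (eq_bigl pred0) ?big_pred0 // => [|u]; last by rewrite !inE.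
  by move: X1; rewrite A1 cards0 /=; lra.
have A2 : (1 < A)%N by rewrite N1 cards1 in m_lt.
have := mul2_flip_prob_le R A2; rewrite N1 cards1.
have [vt|vt] := boolP (v \in cluster t u (s v)).
  rewrite sumE big1; first by nra.
  by move=> u'; rewrite inE N1 in_set1 => /andP[/eqP-> ]; rewrite vt.
have uN : u \in nbrs s v c by rewrite N1 set11.
have AE := card_cluster1 esym st csv N1 vt.
rewrite sumE (eq_bigl (pred1 u)) => [|u']; last first.
  by rewrite inE N1 in_set1 /=; case: eqP => // ->; rewrite vt.
rewrite big_pred1_eq.
have tu := nbr_col eirr st uN.
have -> : fshare t v u (s v) = p #|cluster t u (s v)|.
  rewrite /fshare (_ : [set _ in _ | _] = [set u]) ?cards1 ?divr1 //.
  apply/setP=> u'; rewrite inE tu -[_ && (t u' == c)](_ : u' \in nbrs s v c = _).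
    by rewrite N1 in_set1; case: eqP => [->|]; rewrite ?cluster_refl ?andbF.
  rewrite (nbrs_agree eirr _ st) inE //.
have XZ : F (flip s v c) = F (flip t u (s v)).
  congr F; apply/ffunP => x; have [->|xv] := eqVneq x v.
    by rewrite flip_in ?cluster_refl // mate_id flip_out.
  have [xt|xt] := boolP (x \in cluster t u (s v)); last first.
    apply: (flip_joint esym eirr st csv uN vt).
    rewrite in_setD xt /=; apply: contra xt => xs.
    have := subsetP (cluster_coverN e st csv) x xs.
    by rewrite N1 big_set1 in_setU1 (negbTE xv).
  by apply: (flip_joint esym eirr st csv uN vt); rewrite in_setD xt.
move: X1; rewrite XZ /A /c AE; set Z := F _ => X1.
have d := flip_dist_rev e t HF u (s v).
have a0 : (0 < #|cluster t u (s v)|)%N by apply/card_gt0P; exists u; apply: cluster_refl.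
have := flip_prob_diff_merge R a0; have := flip_probS R #|cluster t u (s v)|.
have := flip_prob_ge0 R #|cluster t u (s v)|.+1.
have := flip_prob_le1 R #|cluster t u (s v)|.+1.
move: d; rewrite -/Z; rewrite /h in h0 *; move: (p _) (p _.+1) => pa pa1.
move: (_%:R) => a d H1 H2 H3 H4 _; nra.
Qed.

End MergingColor.

Lemma joint_cost (R : realFieldType) (p1 p0 x z h : R) :
  0 <= p1 <= 1 -> 0 <= h -> x - z <= h -> p1 * x - p0 * z <= h + (p0 - p1) * - z.
Proof. by move=> /andP[p10 p11] h0 xz; nra. Qed.

Section OneSide.
Variables (R : realFieldType) (T : finType) (e : rel T) (k : nat).
Hypotheses (esym : symmetric e) (eirr : irreflexive e).
Notation col := {ffun T -> 'I_k}.
Notation cluster := (cluster e).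
Notation flip := (flip e).
Notation p := (flip_prob R).
Notation nbrs := (nbrs e).
Notation blockers := (blockers e).
Implicit Types (s t : col) (c : 'I_k) (x y v u : T) (F : col -> R).

Section Side.
Variables (F : col -> R) (s t : col) (v : T) (c : 'I_k).
Hypotheses (HF : hamming_lip F) (st : agree v s t) (csv : c != s v) (ctv : c != t v).
Hypothesis stv : s v != t v.
Let h : R := 1 - (F s - F t).
Hypothesis h0 : 0 <= h.
Notation N := (nbrs s v c).
Notation A := #|cluster s v c|.
Notation a u := #|cluster t u (s v)|.
Notation X := (F (flip s v c) - F s).
Notation Z u := (F (flip t u (s v)) - F t).

Lemma vdriftE : vdrift e F s t v c =
  p A * X - \sum_(u in N) fshare R e t v u (s v) * Z u.
Proof.
congr (_ - _); apply: eq_bigl => u; rewrite csv /=.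
rewrite (nbrs_agree eirr _ st); case: (boolP (u \in _)) => [uN|].
  move: (uN); rewrite inE => /andP[-> ->] /=.
  by rewrite -(nbrs_agree eirr _ st) in uN; rewrite (nbr_out eirr st ctv stv uN).
by rewrite inE; case: (e v u) => //= /negbTE ->.
Qed.

Lemma share_set u : u \in N ->
  [set u' in cluster t u (s v) | e v u' && (t u' == t u)] = N :&: cluster t u (s v).
Proof.
move=> uN; rewrite (nbr_col eirr st uN) (nbrs_agree eirr _ st) setIC.
by apply/setP=> x; rewrite !in_set.
Qed.

Lemma nbr_cluster_gt0 u : (0 < a u)%N.
Proof. by apply/card_gt0P; exists u; apply: cluster_refl. Qed.

Lemma joint_flip_le u : u \in N -> X - Z u <= A%:R - (a u)%:R - 1 + h.
Proof.
move=> uN; have [H _] := joint_dist esym eirr HF st csv uN (nbr_out eirr st ctv stv uN).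
by rewrite /h; lra.
Qed.

Lemma side_one u : N = [set u] ->
  vdrift e F s t v c <= h + (p (a u) - p (a u).+1) * - Z u.
Proof.
move=> N1; have uN : u \in N by rewrite N1 set11.
have AE := card_cluster1 esym st csv N1 (nbr_out eirr st ctv stv uN).
have := joint_flip_le uN; rewrite vdriftE N1 big_set1 {1}/fshare share_set // N1.
rewrite (setIidPl _) ?sub1set ?cluster_refl // cards1 divr1 AE -natr1 => H.
by apply: joint_cost; rewrite // ?flip_prob_ge0 ?flip_prob_le1 //; lra.
Qed.

Lemma side_same u1 u2 : u1 != u2 -> N = [set u1; u2] -> u2 \in cluster t u1 (s v) ->
  vdrift e F s t v c <= 268 / 1000 + h.
Proof.
move=> u12 N2 u21.
have u1N : u1 \in N by rewrite N2 !inE eqxx.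
have u2N : u2 \in N by rewrite N2 !inE eqxx orbT.
have vt := nbr_out eirr st ctv stv u1N.
have AE := card_cluster_same esym eirr st csv N2 vt u21.
have cE := nbr_clusters_eq esym eirr st u1N u2N u21 (cluster_refl _ _ _ _).
have fE : flip t u2 (s v) = flip t u1 (s v).
  by apply: flip_eq; rewrite ?cE // (nbr_col eirr st u1N) (nbr_col eirr st u2N).
have sub : N \subset cluster t u1 (s v).
  rewrite N2; apply/subsetP=> x; rewrite in_set2 => /orP[]/eqP-> //.
  exact: cluster_refl.
have a2 : (1 < a u1)%N.
  by apply: leq_trans (subset_leq_card sub); rewrite N2 cards2 u12.
have dZ := flip_dist_rev e t HF u1 (s v).
have := joint_flip_le u1N; rewrite vdriftE.
rewrite N2 big_setU1 ?in_set1 //= big_set1 /fshare !share_set // -cE fE.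
rewrite (setIidPl sub) N2 cards2 u12 AE -natr1 => H.
rewrite -mulrDl -splitr; apply: (@le_trans _ _ (h + (p (a u1) - p (a u1).+1) * - Z u1)).
  by apply: joint_cost; rewrite // ?flip_prob_ge0 ?flip_prob_le1 //; lra.
have := flip_prob_diff2 R a2; have := flip_probS R (a u1).
have {}dZ : - Z u1 <= (a u1)%:R by lra.
move: dZ; move: (- Z u1) => z dZ H1 H2; nra.
Qed.

Lemma side_distinct u1 u2 : u1 != u2 -> N = [set u1; u2] ->
  u2 \notin cluster t u1 (s v) ->
  exists q1 q2 d : R,
  [/\ 0 <= q1 <= 1, 0 <= q2 <= 1,
      vdrift e F s t v c <= d + h + (q1 * - Z u1 + q2 * - Z u2) &
      forall x y : bool, ((a u1)%:R - x%:R) * q1 + ((a u2)%:R - y%:R) * q2 + d +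
        9 / 100 * ((x && (a u1 == 1%N))%:R + (y && (a u2 == 1%N))%:R) <= two_bound R x y].
Proof.
move=> u12 N2 u21.
have u1N : u1 \in N by rewrite N2 !inE eqxx.
have u2N : u2 \in N by rewrite N2 !inE eqxx orbT.
have vt1 := nbr_out eirr st ctv stv u1N; have vt2 := nbr_out eirr st ctv stv u2N.
have AE := card_cluster2 esym eirr st csv N2 vt1 vt2 u21.
have X1 : X - Z u1 <= (a u2)%:R + h.
  by have := joint_flip_le u1N; rewrite AE -natr1 natrD; lra.
have X2 : X - Z u2 <= (a u1)%:R + h.
  by have := joint_flip_le u2N; rewrite AE -natr1 natrD; lra.
have [q1 [q2 [d [H1 H2 H3 H4]]]] :=
  side_two (nbr_cluster_gt0 u1) (nbr_cluster_gt0 u2) h0 X1 X2.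
exists q1, q2, d; split=> //; apply: le_trans H3; rewrite vdriftE AE.
rewrite N2 big_setU1 ?in_set1 //= big_set1 /fshare !share_set //.
have -> : N :&: cluster t u1 (s v) = [set u1].
  rewrite N2 setIUl (setIidPl _) ?sub1set ?cluster_refl //.
  rewrite (_ : _ :&: _ = set0) ?setU0 //; apply/setP=> x; rewrite in_setI in_set1 in_set0.
  by case: eqP => [->|//]; rewrite (negbTE u21).
have -> : N :&: cluster t u2 (s v) = [set u2].
  rewrite N2 setIUl setUC (setIidPl _) ?sub1set ?cluster_refl //.
  rewrite (_ : _ :&: _ = set0) ?setU0 //; apply/setP=> x; rewrite in_setI in_set1 in_set0.
  case: eqP => [->|//]; apply/negP => u12'; case/negP: u21.
  by rewrite (nbr_clusters_eq esym eirr st u1N u2N (cluster_refl _ _ _ _) u12') cluster_refl.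
by rewrite !cards1 !divr1.
Qed.

End Side.
End OneSide.

Lemma card_set_sum (R : realFieldType) (T : finType) (A : {set T}) (P : pred T) :
  #|[set u in A | P u]|%:R = \sum_(u in A) (P u)%:R :> R.
Proof.
rewrite -sum1_card natr_sum big_mkcond [RHS]big_mkcond /=; apply: eq_bigr => u _.
by rewrite inE; case: (u \in A); case: (P u).
Qed.

Lemma sum_affine (R : realFieldType) (T : finType) (A : {set T}) (P : pred T) (x y z : R) :
  \sum_(u in A) (x - y * (P u)%:R + z) = #|A|%:R * (x + z) - y * #|[set u in A | P u]|%:R.
Proof.
rewrite card_set_sum mulr_sumr mulr_natl -sumr_const -sumrB.
by apply: eq_bigr => u _; ring.
Qed.

Section TwoSides.
Variables (R : realFieldType) (T : finType) (e : rel T) (k : nat).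
Hypotheses (esym : symmetric e) (eirr : irreflexive e).
Notation col := {ffun T -> 'I_k}.
Notation cluster := (cluster e).
Notation flip := (flip e).
Notation p := (flip_prob R).
Notation nbrs := (nbrs e).
Notation blockers := (blockers e).
Implicit Types (s t : col) (c : 'I_k) (x y v u : T).

Variables (F : col -> R) (s t : col) (v : T) (c : 'I_k).
Hypotheses (HF : hamming_lip F) (st : agree v s t) (csv : c != s v) (ctv : c != t v).
Hypothesis stv : s v != t v.
Let h : R := 1 - (F s - F t).
Hypothesis h0 : 0 <= h.
Notation N := (nbrs s v c).
Notation a u := #|cluster t u (s v)|.
Notation b u := #|cluster s u (t v)|.
Notation G := (fun s' : col => - F s').

Let ts : agree v t s := agree_sym st.
Let HG : hamming_lip G := hlipN HF.
Let tsv : t v != s v. Proof. by rewrite eq_sym. Qed.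
Let Nts : nbrs t v c = N. Proof. by rewrite -(nbrs_agree eirr _ st). Qed.
Let hG : 1 - (G t - G s) = h. Proof. by rewrite /h; ring. Qed.
Let h0G : 0 <= 1 - (G t - G s). Proof. by rewrite hG. Qed.

Lemma nbr_pair u (q q' : R) : u \in N -> 0 <= q <= 1 -> 0 <= q' <= 1 ->
  exists x : bool,
    q * - (F (flip t u (s v)) - F t) + q' * - (G (flip s u (t v)) - G s) <=
    ((a u)%:R - x%:R) * q + ((b u)%:R - (~~ x)%:R) * q' + h.
Proof.
move=> uN q01 q01'; apply: pair_cost => //.
- by have := flip_dist_rev e t HF u (s v); lra.
- by have := flip_dist e s HF u (t v); lra.
by have := both_dist HF st csv ctv stv uN; rewrite /h; lra.
Qed.

Lemma color_cost1 u : N = [set u] ->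
  vdrift e F s t v c + vdrift e G t s v c <=
  832 / 1000 - 9 / 100 * (blockers s t v u == 0%N)%:R + 25 / 10000 * (blockers s t v u == 1%N)%:R
  + 3 * h.
Proof.
move=> N1; have uN : u \in N by rewrite N1 set11.
have sF := side_one esym eirr HF st csv ctv stv h0 N1.
have N1' : nbrs t v c = [set u] by rewrite Nts.
have := side_one esym eirr HG ts ctv csv tsv h0G N1'; rewrite hG => sG.
have a0 : (0 < a u)%N by apply/card_gt0P; exists u; apply: cluster_refl.
have b0 : (0 < b u)%N by apply/card_gt0P; exists u; apply: cluster_refl.
have B := blk_le eirr st csv ctv stv uN.
have B0 := blk0 eirr st stv uN.
have q01 n : 0 <= p n - p n.+1 <= 1.
  by have := flip_probS R n; have := flip_prob_le1 R n; have := flip_prob_ge0 R n.+1; lra.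
have [x Hx] := nbr_pair uN (q01 (a u)) (q01 (b u)).
have C1 := one_cost R a0 b0 B B0.
have C2 : ((b u)%:R - 1) * (p (b u) - p (b u).+1) + (a u)%:R * (p (a u) - p (a u).+1) <=
   832 / 1000 - 9 / 100 * (blockers s t v u == 0%N)%:R + 25 / 10000 * (blockers s t v u == 1%N)%:R.
  by apply: one_cost => //; [rewrite addnC | move/B0 => -[-> ->]].
move: sF sG Hx C1 C2; rewrite -/h; case: x; rewrite /= ?mulr1n ?mulr0n ?subr0; lra.
Qed.

Lemma color_cost2 u1 u2 : u1 != u2 -> N = [set u1; u2] ->
  vdrift e F s t v c + vdrift e G t s v c <=
  2664 / 1000 - 9 / 100 * ((blockers s t v u1 == 0%N)%:R + (blockers s t v u2 == 0%N)%:R) + 4 * h.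
Proof.
move=> u12 N2; have N2' : nbrs t v c = [set u1; u2] by rewrite Nts.
have u1N : u1 \in N by rewrite N2 !inE eqxx.
have u2N : u2 \in N by rewrite N2 !inE eqxx orbT.
have B1 := blk0 eirr st stv u1N; have B2 := blk0 eirr st stv u2N.
have ncl1 s' (d : 'I_k) u u' : u != u' -> u' \in cluster s' u d -> #|cluster s' u d| != 1%N.
  move=> uu' u'in; apply/eqP => /eqP/cards1P[x cx].
  have := cluster_refl e s' u d; move: u'in uu'; rewrite cx !in_set1.
  by move=> /eqP-> /[swap] /eqP->; rewrite eqxx.
have g1 u' : (blockers s t v u' == 0%N)%:R <= 1 :> R by case: eqP => _; rewrite ?mulr0n ?ler01 ?lexx.
have b10 u' : (blockers s t v u' != 0)%N -> (blockers s t v u' == 0%N)%:R = 0 :> R by move/negbTE->.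
have [aS|aD] := boolP (u2 \in cluster t u1 (s v)).
  have sF := side_same esym eirr HF st csv ctv stv h0 u12 N2 aS.
  have k1 : (blockers s t v u1 != 0)%N.
    by apply/eqP => /B1 [/eqP]; rewrite (negbTE (ncl1 _ _ _ _ u12 aS)).
  have aE := nbr_clusters_eq esym eirr st u1N u2N aS (cluster_refl _ _ _ _).
  have k2 : (blockers s t v u2 != 0)%N.
    by apply/eqP => /B2 [/eqP]; rewrite -aE (negbTE (ncl1 _ _ _ _ u12 aS)).
  rewrite !b10 //.
  have [bS|bD] := boolP (u2 \in cluster s u1 (t v)).
    have := side_same esym eirr HG ts ctv csv tsv h0G u12 N2' bS; rewrite hG.
    by move: sF; rewrite -/h; move: h0; lra.
  have [q1 [q2 [d]]] := side_distinct esym eirr HG ts ctv csv tsv h0G u12 N2' bD.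
  rewrite hG => -[/andP[q10 q11] /andP[q20 q21] sG /(_ false false)].
  rewrite /two_bound /= !mulr0n => H2.
  have d1 := flip_dist e s HF u1 (t v); have d2 := flip_dist e s HF u2 (t v).
  have : q1 * - (G (flip s u1 (t v)) - G s) <= q1 * (b u1)%:R by apply: ler_wpM2l => //; lra.
  have : q2 * - (G (flip s u2 (t v)) - G s) <= q2 * (b u2)%:R by apply: ler_wpM2l => //; lra.
  by move: sF sG; rewrite -/h; move: h0; lra.
have [q1 [q2 [d [q1P q2P sF HF']]]] := side_distinct esym eirr HF st csv ctv stv h0 u12 N2 aD.
have [bS|bD] := boolP (u2 \in cluster s u1 (t v)).
  have sG := side_same esym eirr HG ts ctv csv tsv h0G u12 N2' bS.
  rewrite hG in sG.
  have k1 : (blockers s t v u1 != 0)%N.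
    by apply/eqP => /B1 [_ /eqP]; rewrite (negbTE (ncl1 _ _ _ _ u12 bS)).
  have u1N' : u1 \in nbrs t v c by rewrite Nts.
  have u2N' : u2 \in nbrs t v c by rewrite Nts.
  have aE := nbr_clusters_eq esym eirr ts u1N' u2N' bS (cluster_refl _ _ _ _).
  have k2 : (blockers s t v u2 != 0)%N.
    by apply/eqP => /B2 [_ /eqP]; rewrite -aE (negbTE (ncl1 _ _ _ _ u12 bS)).
  rewrite !b10 //.
  move: q1P q2P HF' => /andP[q10 q11] /andP[q20 q21] /(_ false false).
  rewrite /two_bound /= !mulr0n => H2.
  have d1 := flip_dist_rev e t HF u1 (s v); have d2 := flip_dist_rev e t HF u2 (s v).
  have : q1 * - (F (flip t u1 (s v)) - F t) <= q1 * (a u1)%:R by apply: ler_wpM2l => //; lra.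
  have : q2 * - (F (flip t u2 (s v)) - F t) <= q2 * (a u2)%:R by apply: ler_wpM2l => //; lra.
  by move: sF sG; rewrite -/h; move: h0; lra.
have [r1 [r2 [d' [r1P r2P sG HG']]]] := side_distinct esym eirr HG ts ctv csv tsv h0G u12 N2' bD.
rewrite hG in sG.
have [x Hx] := nbr_pair u1N q1P r1P; have [y Hy] := nbr_pair u2N q2P r2P.
have := HF' x y; have := HG' (~~ x) (~~ y); have := two_boundE R x y.
have gd u (z : bool) : (blockers s t v u = 0%N -> a u = 1%N /\ b u = 1%N) ->
  (blockers s t v u == 0%N)%:R <= (z && (a u == 1%N))%:R + (~~ z && (b u == 1%N))%:R :> R.
  case: eqP => [E H|_ _]; last by rewrite -natrD ler0n.
  by have [-> ->] := H E; case: z; rewrite /= ?addr0 ?add0r lexx.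
have := gd u1 x B1; have := gd u2 y B2; move: Hx Hy sF sG; rewrite -/h.
by move: h0; lra.
Qed.

Lemma weighted_pair u (q q' : R) : u \in N -> 0 <= q <= p (a u) -> 0 <= q' <= p (b u) ->
  q * - (F (flip t u (s v)) - F t) + q' * - (G (flip s u (t v)) - G s) <=
  1332 / 1000 - 332 / 1000 * (blockers s t v u == 0%N)%:R + h.
Proof.
move=> uN /andP[q0 qa] /andP[r0 rb].
have pa1 := flip_prob_le1 R (a u); have pb1 := flip_prob_le1 R (b u).
have q01 : 0 <= q <= 1 by rewrite q0 (le_trans qa).
have r01 : 0 <= q' <= 1 by rewrite r0 (le_trans rb).
have [x Hx] := nbr_pair uN q01 r01; apply: le_trans Hx _; rewrite lerD2r.
have a0 : (0 < a u)%N by apply/card_gt0P; exists u; apply: cluster_refl.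
have b0 : (0 < b u)%N by apply/card_gt0P; exists u; apply: cluster_refl.
have B0 := blk0 eirr st stv uN.
case: eqP => [/B0 [-> ->]|_].
  by case: x; rewrite /= ?mulr1n ?mulr0n; lra.
have a1 := mul1_flip_prob_le R a0; have b1 := mul1_flip_prob_le R b0.
have a2 := mul_flip_prob_le1 R (a u); have b2 := mul_flip_prob_le1 R (b u).
have aq : (a u)%:R * q <= (a u)%:R * p (a u) by rewrite ler_wpM2l.
have bq : (b u)%:R * q' <= (b u)%:R * p (b u) by rewrite ler_wpM2l.
have aq1 : ((a u)%:R - 1) * q <= ((a u)%:R - 1) * p (a u).
  by rewrite ler_wpM2l // subr_ge0 ler1n.
have bq1 : ((b u)%:R - 1) * q' <= ((b u)%:R - 1) * p (b u).
  by rewrite ler_wpM2l // subr_ge0 ler1n.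
by case: x; rewrite /= ?mulr1n ?mulr0n ?subr0; lra.
Qed.

Lemma big_flips (A B m : nat) (X Y : R) : (3 <= m)%N -> (m < A)%N -> (m < B)%N ->
  X <= A%:R -> Y <= B%:R -> X + Y <= A%:R + B%:R - m%:R - 3 + h ->
  p A * X + p B * Y <= 4 / 10 + h.
Proof.
move=> m3 mA mB XA YB XY.
have pA0 := flip_prob_ge0 R A; have pB0 := flip_prob_ge0 R B.
have pA1 := flip_prob_le1 R A; have pB1 := flip_prob_le1 R B.
have A4 : A%:R * p A <= 4 / 10 by apply/mul_flip_prob_le4/(leq_ltn_trans m3 mA).
have B4 : B%:R * p B <= 4 / 10 by apply/mul_flip_prob_le4/(leq_ltn_trans m3 mB).
have m3R : 3 <= m%:R :> R by rewrite ler_nat.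
have neg n : (n%:R - 6) * p n <= 0.
  have [n7|n6] := leqP 7 n; first by rewrite flip_prob_large // mulr0.
  by rewrite mulr_le0_ge0 ?flip_prob_ge0 // subr_le0 ler_nat.
have nA := neg A; have nB := neg B; have := h0; move: (h) XY => h' XY h'0.
by have [pAB|/ltW pAB] := leP (p A) (p B); nra.
Qed.

Lemma color_cost3 : (3 <= #|N|)%N ->
  vdrift e F s t v c + vdrift e G t s v c <=
  4 / 10 + 1332 / 1000 * #|N|%:R -
    332 / 1000 * #|[set u in N | blockers s t v u == 0%N]|%:R + (1 + #|N|%:R) * h.
Proof.
move=> m3; rewrite (vdriftE eirr F st csv ctv stv) (vdriftE eirr G ts ctv csv tsv) Nts.
set X := F (flip s v c) - F s; set Y := G (flip t v c) - G t.
set S1 := \sum_(u in N) _; set S2 := \sum_(u in N) _.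
have big : p #|cluster s v c| * X + p #|cluster t v c| * Y <= 4 / 10 + h.
  apply: (big_flips m3).
  - exact: (card_cluster_nbrs eirr csv).
  - by have := card_cluster_nbrs eirr ctv; rewrite Nts.
  - exact: flip_dist.
  - by have := flip_dist_rev e t HF v c; rewrite /Y; lra.
  by have := flips_dist eirr HF st csv ctv stv; rewrite /X /Y /h; lra.
have small : - S1 - S2 <= \sum_(u in N)
    (1332 / 1000 - 332 / 1000 * (blockers s t v u == 0%N)%:R + h).
  rewrite -!sumrN -big_split /=; apply: ler_sum => u uN.
  have vu : e v u by move: uN; rewrite inE => /andP[].
  by have := weighted_pair uN (fshareP R t (s v) vu) (fshareP R s (t v) vu); rewrite !mulrN.
rewrite (sum_affine N (fun u => blockers s t v u == 0%N)) in small.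
move: big small; move: (p _ * X) (p _ * Y) S1 S2 => x y S1 S2 big small.
by have := h0; move: (h) big small => h'; lra.
Qed.

(* 9/100 per unblocked neighbour pays for its future loss; 25/10000 is the excess at a neighbour
   with exactly one blocker. *)
Lemma color_cost :
  vdrift e F s t v c - vdrift e F t s v c <=
  1832 / 1000 * #|N|%:R - 1 - 9 / 100 * #|[set u in N | blockers s t v u == 0%N]|%:R
  + 25 / 10000 * #|[set u in N | blockers s t v u == 1%N]|%:R + (2 + 2 * #|N|%:R) * h.
Proof.
rewrite -vdriftN.
have [m3|] := leqP 3 #|N|.
  have := color_cost3 m3.
  have : #|[set u in N | blockers s t v u == 0%N]|%:R <= #|N|%:R :> R.
    by rewrite ler_nat; apply/subset_leq_card/subsetP => u; rewrite inE => /andP[].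
  have : 0 <= #|[set u in N | blockers s t v u == 1%N]|%:R :> R by rewrite ler0n.
  have : 3 <= #|N|%:R :> R by rewrite ler_nat.
  have : 0 <= #|[set u in N | blockers s t v u == 0%N]|%:R :> R by rewrite ler0n.
  have : 0 <= #|N|%:R * h by rewrite mulr_ge0 ?ler0n.
  by move: h0; move: (h) => h'; lra.
rewrite ltnS leq_eqVlt => /orP[/cards2P[u1 [u2 [u12 N2]]]|].
  have := color_cost2 u12 N2; rewrite !card_set_sum N2 !big_setU1 ?in_set1 //= !big_set1.
  rewrite cards2 u12 /=.
  have : 0 <= (blockers s t v u1 == 1%N)%:R :> R by rewrite ler0n.
  have : 0 <= (blockers s t v u2 == 1%N)%:R :> R by rewrite ler0n.
  by move: h0; lra.
rewrite ltnS leq_eqVlt => /orP[/cards1P[u N1]|].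
  have := color_cost1 N1; rewrite !card_set_sum N1 !big_set1 cards1.
  by move: h0; lra.
rewrite ltnS leqn0 => /eqP/cards0_eq N0.
rewrite (vdriftE eirr F st csv ctv stv) (vdriftE eirr G ts ctv csv tsv) Nts N0 !big_set0 cards0.
rewrite (_ : [set u in set0 | _] = set0) ?cards0; last by apply/setP=> u; rewrite !inE.
rewrite (_ : [set u in set0 | _] = set0) ?cards0; last by apply/setP=> u; rewrite !inE.
have := flips_dist eirr HF st csv ctv stv; rewrite (card_cluster0 eirr st csv N0).
rewrite (card_cluster0 eirr ts ctv) ?Nts // N0 cards0 /=.
by move: h0; rewrite /h; lra.
Qed.

End TwoSides.

(** * Contraction of the weighted metric *)

Lemma degree_slack (R : realFieldType) (d k : nat) (m B : R) :
  (d + 2 <= k)%N -> (11 / 6 - 94 / 10 ^+ 6) * d%:R <= k%:R :> R ->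
  0 <= B <= m -> m <= d%:R ->
  1832 / 1000 * m + 25 / 10000 * B - 15 / 1000 / k%:R * ((k%:R - 2 - d%:R) * B) <=
  k%:R - k%:R / 10000.
Proof.
move=> dk; rewrite -natrX => dkR /andP[B0 Bm] md.
have dkR2 : d%:R + 2 <= k%:R :> R by rewrite -natrD ler_nat.
have k0 : 0 < k%:R :> R by rewrite ltr0n; apply: leq_trans dk; rewrite addnC.
set eta := 15 / 1000 / k%:R; have ek : eta * k%:R = 15 / 1000 by rewrite divfK // gt_eqF.
have eta0 : 0 <= eta by rewrite divr_ge0 ?ler0n //; lra.
have [d3|d2] := leqP 3 d; last first.
  have : 0 <= eta * ((k%:R - 2 - d%:R) * B).
    by rewrite mulr_ge0 // mulr_ge0 //; clear -dkR2; lra.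
  have : d%:R <= 2 :> R by rewrite ler_nat.
  by clear -dkR2 B0 Bm md; lra.
have kd : 5 * k%:R >= 6 * d%:R + 12 :> R.
  move: d3; rewrite leq_eqVlt => /orP[/eqP d3|d4].
    have k6 : (6 <= k)%N.
      rewrite ltnNge; apply/negP => k5.
      have k5R : k%:R <= 5 :> R by rewrite ler_nat.
      by move: dkR; rewrite -d3; clear -k5R; lra.
    have k6R : 6 <= k%:R :> R by rewrite ler_nat.
    by rewrite -d3; clear -k6R; lra.
  have d4R : 4 <= d%:R :> R by rewrite ler_nat.
  by clear -dkR d4R; lra.
have gain : 25 / 10000 * B <= eta * ((k%:R - 2 - d%:R) * B).
  rewrite mulrA ler_wpM2r //; apply: (@le_trans _ _ (eta * (k%:R / 6))).
    by rewrite mulrA ek; clear; lra.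
  by rewrite ler_wpM2l //; clear -kd; lra.
by clear -gain dkR md B0 k0; lra.
Qed.

Lemma weight_slack (R : realFieldType) (d k : nat) (m U xi n : R) :
  (d + 2 <= k)%N -> m <= d%:R -> 0 <= U -> 0 <= xi -> 1 <= n ->
  (2 * k%:R + 2 * m) * (xi + 15 / 1000 / k%:R * U) <= 4 * (n * k%:R * xi) + 6 / 100 * U
  /\ 15 / 1000 / k%:R * (2 * d%:R * U) <= 3 / 100 * U.
Proof.
move=> dk md U0 xi0 n1.
have dkR2 : d%:R + 2 <= k%:R :> R by rewrite -natrD ler_nat.
have k0 : 0 < k%:R :> R by rewrite ltr0n; apply: leq_trans dk; rewrite addnC.
set eta := 15 / 1000 / k%:R; have ek : eta * k%:R = 15 / 1000 by rewrite divfK // gt_eqF.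
have eta0 : 0 <= eta by rewrite divr_ge0 ?ler0n //; lra.
have eU : 0 <= eta * U by rewrite mulr_ge0.
split.
  apply: (@le_trans _ _ (4 * k%:R * (xi + eta * U))).
    by rewrite ler_wpM2r ?addr_ge0 //; clear -md dkR2; lra.
  rewrite mulrDr; apply: lerD; last first.
    by rewrite mulrA -(mulrA 4) (mulrC k%:R) ek; clear; lra.
  by rewrite -mulrA ler_wpM2l ?ler0n // -mulrA ler_peMl // mulr_ge0 ?ler0n.
rewrite mulrA ler_wpM2r //; apply: (@le_trans _ _ (eta * (2 * k%:R))).
  by rewrite ler_wpM2l //; clear -dkR2; lra.
by rewrite mulrCA ek; clear; lra.
Qed.

Lemma drift_sum (R : realFieldType) (S C nkx u b m B K U hh : R) :
  S <= nkx + (u - b) -> u <= 3 / 100 * U -> hh <= 4 * nkx + 6 / 100 * U ->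
  C <= 1832 / 1000 * m - K - 9 / 100 * U + 25 / 10000 * B + hh ->
  1832 / 1000 * m + 25 / 10000 * B - b <= K - K / 10000 ->
  S + C <= 5 * nkx - K / 10000.
Proof. lra. Qed.

Section Contraction.
Variables (R : realFieldType) (T : finType) (e : rel T) (k : nat).
Hypotheses (esym : symmetric e) (eirr : irreflexive e).
Notation col := {ffun T -> 'I_k}.
Notation cluster := (cluster e).
Notation flip := (flip e).
Notation p := (flip_prob R).
Notation nbrs := (nbrs e).
Notation blockers := (blockers e).
Implicit Types (s t : col) (c : 'I_k) (x y v u : T) (F : col -> R).

Definition unblocked s t v := #|[set u | e v u && (blockers s t v u == 0%N)]|.
Definition pair_weight s t v : R := 1 - 15 / 1000 / k%:R * (unblocked s t v)%:R.
Definition pair_lip F := forall v s t, agree v s t -> s v != t v -> F s - F t <= pair_weight s t v.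

Lemma pair_weight_le1 s t v : pair_weight s t v <= 1.
Proof. by rewrite /pair_weight gerBl mulr_ge0 ?ler0n // divr_ge0 ?ler0n //; lra. Qed.

Lemma lip_hlip F : pair_lip F -> hamming_lip F.
Proof.
move=> LF W s t; have [m Wm] : {m | #|W| = m} by exists #|W|.
rewrite Wm; elim: m W Wm s => [|m IH] W Wm s st.
  suff -> : s = t by rewrite subrr.
  by apply/ffunP => x; apply: st; rewrite (cards0_eq Wm) in_set0.
have [x xW] : exists x, x \in W by apply/card_gt0P; rewrite Wm.
pose s' : col := [ffun y => if y == x then t x else s y].
have s's : F s - F s' <= 1.
  have [E|nE] := eqVneq (s x) (t x).
    suff -> : s' = s by rewrite subrr ler01.
    by apply/ffunP => y; rewrite ffunE; case: eqP => // ->.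
  apply: le_trans (pair_weight_le1 s s' x); apply: LF.
    by move=> y yx; rewrite ffunE (negbTE yx).
  by rewrite ffunE eqxx.
have Wx : #|W :\ x| = m by have := cardsD1 x W; rewrite xW Wm => -[].
have H : F s' - F t <= m%:R.
  apply: (IH _ Wx) => y; rewrite in_setD1 negb_and negbK ffunE => /orP[/eqP->|yW].
    by rewrite eqxx.
  by case: eqP => [->//|_]; apply: st.
by rewrite -natr1; lra.
Qed.

Lemma color_cost_all F s t v c : hamming_lip F -> agree v s t -> s v != t v ->
  0 <= 1 - (F s - F t) ->
  vdrift e F s t v c - vdrift e F t s v c <=
  1832 / 1000 * #|nbrs s v c|%:R - 1
  - 9 / 100 * #|[set u in nbrs s v c | blockers s t v u == 0%N]|%:R
  + 25 / 10000 * #|[set u in nbrs s v c | blockers s t v u == 1%N]|%:R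
  + (2 + 2 * #|nbrs s v c|%:R) * (1 - (F s - F t)).
Proof.
move=> HF st stv h0.
have zero s' t' : vdrift e F s' t' v (s' v) = 0.
  by rewrite /vdrift flip_self subrr mulr0 big_pred0 ?subr0 // => u; rewrite eqxx /= !andbF.
have g1 : #|[set u in nbrs s v c | blockers s t v u == 0%N]|%:R <= #|nbrs s v c|%:R :> R.
  by rewrite ler_nat; apply/subset_leq_card/subsetP => u; rewrite inE => /andP[].
have b0 : 0 <= #|[set u in nbrs s v c | blockers s t v u == 1%N]|%:R :> R by rewrite ler0n.
have m0 : 0 <= #|nbrs s v c|%:R :> R by rewrite ler0n.
have [ct|ct] := eqVneq c (t v).
  rewrite {2}ct zero subr0; have := vdrift_merge esym eirr HF st stv h0.
  by rewrite -ct; nra.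
have [cs|cs] := eqVneq c (s v); last exact: color_cost.
have h1 : 0 <= 1 - ((fun s => - F s) t - (fun s => - F s) s) by lra.
have := vdrift_merge esym eirr (hlipN HF) (agree_sym st) _ h1.
rewrite {1}cs zero sub0r -vdriftN eq_sym => /(_ stv); rewrite -cs -(nbrs_agree eirr _ st).
by nra.
Qed.

Lemma sum_nbrs (P : pred T) s v :
  \sum_c #|[set u in nbrs s v c | P u]|%:R = #|[set u | e v u && P u]|%:R :> R.
Proof.
rewrite -natr_sum -[in RHS]sum1_card (partition_big (fun u => s u) predT) //=.
congr (_%:R); apply: eq_bigr => c _; rewrite -sum1_card; apply: eq_bigl => u.
by rewrite !inE -!andbA; congr andb; rewrite andbC.
Qed.

Lemma common_flip s t v (x : T) c : agree v s t ->
  v \notin cluster s x c -> v \notin cluster t x c ->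
  [/\ agree v (flip s x c) (flip t x c), flip s x c v = s v & flip t x c v = t v].
Proof.
move=> st vs vt; rewrite !flip_out //; split=> // y yv.
rewrite !ffunE -(cluster_common st vs vt) -(st x) -?(st y) //.
by apply: contraNneq vs => <-; apply: cluster_refl.
Qed.

Lemma blk_flip s t v u x c : v \notin cluster s x c -> v \notin cluster t x c ->
  blockers (flip s x c) (flip t x c) v u =
  #|[set w | [&& e u w, w != v & (flip s x c w == s v) || (flip s x c w == t v)]]|.
Proof. by move=> vs vt; apply: eq_card => w; rewrite !inE (flip_out vs) (flip_out vt). Qed.

Definition fweight s (i : T * 'I_k) : R := p #|cluster s i.1 i.2| / #|cluster s i.1 i.2|%:R.

Lemma fweightP s i : 0 <= fweight s i <= 1.
Proof.
have c0 : (0 < #|cluster s i.1 i.2|)%N by apply/card_gt0P; exists i.1; apply: cluster_refl.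
have /andP[-> H] := ge0_div_le (flip_prob_ge0 R #|cluster s i.1 i.2|) c0.
by apply: le_trans H (flip_prob_le1 _ _).
Qed.

Lemma recolor_rate s w c :
  \sum_(i | w \in cluster s i.1 i.2) fweight s i * (flip s i.1 i.2 w == c)%:R <= 1.
Proof.
have -> := @sum_through R _ _ _ esym s w (fun s' => (s' w == c)%:R).
rewrite (bigD1 c) //= big1 ?addr0.
  by rewrite flip_in ?cluster_refl // mate_id eqxx mulr1 flip_prob_le1.
by move=> c' c'c; rewrite flip_in ?cluster_refl // mate_id (negbTE c'c) mulr0.
Qed.

Section Pair.
Variables (s t : col) (v : T).
Hypotheses (st : agree v s t) (stv : s v != t v).
Notation common := (fun i : T * 'I_k =>
  (v \notin cluster s i.1 i.2) && (v \notin cluster t i.1 i.2)).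
Notation blki i u := (blockers (flip s i.1 i.2) (flip t i.1 i.2) v u).
Notation deg u := #|[set w | e u w]|.

Lemma blocking_rate u : blockers s t v u = 0%N ->
  \sum_(i | common i) fweight s i * (1 - (blki i u == 0%N)%:R) <= 2 * (deg u)%:R.
Proof.
move=> /eqP; rewrite cards_eq0 => /eqP b0.
have nob w : e u w -> w != v -> (s w != s v) && (s w != t v).
  move=> uw wv; have := in_set0 w; rewrite -b0 inE uw wv /= => /negbT.
  by rewrite negb_or.
pose g (i : T * 'I_k) w c : R :=
  (w \in cluster s i.1 i.2)%:R * (fweight s i * (flip s i.1 i.2 w == c)%:R).
have g0 i w c : 0 <= g i w c.
  by have /andP[f0 _] := fweightP s i; do 2 (apply: mulr_ge0; rewrite ?ler0n //).
apply: (@le_trans _ _ (\sum_i \sum_(w in [set w | e u w]) (g i w (s v) + g i w (t v)))).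
  rewrite big_mkcond; apply: ler_sum => i _.
  have S0 : 0 <= \sum_(w in [set w | e u w]) (g i w (s v) + g i w (t v)).
    by apply: sumr_ge0 => w _; rewrite addr_ge0.
  case: ifP => // /andP[vs vt]; case: eqP => [_|]; first by rewrite subrr mulr0.
  rewrite subr0 mulr1 blk_flip // => /eqP; rewrite -lt0n => /card_gt0P[w].
  rewrite inE => /and3P[uw wv fw]; have /andP[ns nt] := nob w uw wv.
  have wS : w \in cluster s i.1 i.2.
    by apply: contraLR fw => /flip_out ->; rewrite negb_or ns nt.
  rewrite (bigD1 w) ?inE //= ler_wpDr ?sumr_ge0 // => [w' _|]; first by rewrite addr_ge0.
  rewrite /g wS !mul1r -mulrDr; have /andP[f0 _] := fweightP s i.
  rewrite ler_peMr //; case/orP: fw => ->; rewrite ?mulr1n.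
    by rewrite lerDl ler0n.
  by rewrite lerDr ler0n.
rewrite exchange_big /= mulr_natr -sumr_const; apply: ler_sum => w _.
have gsum c : \sum_i g i w c <= 1.
  apply: le_trans (recolor_rate s w c); rewrite [X in _ <= X]big_mkcond /=.
  by apply: ler_sum => i _; rewrite /g; case: (w \in _); rewrite ?mul1r ?mul0r.
by rewrite big_split /=; have := gsum (s v); have := gsum (t v); lra.
Qed.

Lemma unblocking_rate u : blockers s t v u = 1%N ->
  exists w, k%:R - 2 - (deg w)%:R <=
    \sum_(i | common i) fweight s i * (blki i u == 0%N)%:R.
Proof.
move=> b1; have /eqP/cards1P[w W1] := b1; exists w.
have: w \in [set w] by rewrite set11.
rewrite -W1 inE => /and3P[uw wv sw].
pose C := ~: ([set s v; t v] :|: [set s x | x in [set x | e w x]]).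
have cardC : k%:R - 2 - (deg w)%:R <= #|C|%:R :> R.
  have : (k <= #|C| + (2 + deg w))%N.
    rewrite -[X in (X <= _)%N]card_ord -(cardsC (~: C)) setCK addnC leq_add2l setCK.
    apply: leq_trans (leq_card_setU _ _).1 _.
    by rewrite leq_add ?leq_imset_card // cards2; case: (_ == _).
  by rewrite -(ler_nat R) !natrD; lra.
apply: le_trans cardC _.
have term c : c \in C -> common (w, c) && (fweight s (w, c) * (blki (w, c) u == 0%N)%:R == 1).
  rewrite in_setC in_setU in_set2 !negb_or => /andP[/andP[cs ct] cN].
  have nc x : e w x -> s x != c.
    by move=> wx; apply: contraNneq cN => <-; apply/imsetP; exists x; rewrite ?inE.
  have csw : c != s w by case/orP: sw => /eqP ->.
  have one s' : s' w = s w -> (forall x, e w x -> s' x != c) -> cluster s' w c = [set w].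
    move=> s'w s'c; apply/eqP; rewrite eqEsubset sub1set cluster_refl andbT.
    apply: cluster_min => [|y z]; rewrite !in_set1 // => /eqP -> /and4P[wz nz _].
    by rewrite eq_sym (negbTE nz) (negbTE (s'c z wz)).
  have cls : cluster s w c = [set w] by apply: one.
  have clt : cluster t w c = [set w].
    apply: one => [|x wx]; first by rewrite st.
    by have [->|xv] := eqVneq x v; [rewrite eq_sym|rewrite -st // nc].
  have vs : v \notin cluster s w c by rewrite cls in_set1 eq_sym.
  have vt : v \notin cluster t w c by rewrite clt in_set1 eq_sym.
  rewrite /= vs vt /= /fweight cls cards1 divr1 /= mul1r blk_flip //=.
  rewrite (_ : [set _ | _] = set0) ?cards0 ?eqxx //; apply/setP => x; rewrite in_set0 inE.
  apply/negP => /and3P[ux xv]; have [xw|xw] := eqVneq x w.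
    by rewrite xw flip_in ?cluster_refl // mate_id (negbTE cs) (negbTE ct).
  rewrite flip_out ?cls ?in_set1 // => sx; case/negP: xw.
  by rewrite -in_set1 -W1 inE ux xv sx.
rewrite -sum1_card natr_sum.
apply: (@le_trans _ _ (\sum_(i | common i && (i \in [set (w, c) | c in C]))
    fweight s i * (blki i u == 0%N)%:R)); last first.
  rewrite [X in _ <= X](bigID (fun i => i \in [set (w, c) | c in C])) /= lerDl.
  apply: sumr_ge0 => i _; have /andP[f0 _] := fweightP s i; by rewrite mulr_ge0 ?ler0n.
rewrite (eq_bigl (fun i => i \in [set (w, c) | c in C])) => [|i]; last first.
  rewrite andbC; apply: andb_idr => /imsetP[c cC ->].
  by have /andP[] := term c cC.
rewrite big_imset /=; last by move=> ? ? _ _ [].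
by apply: ler_sum => c /term /andP[_ /eqP ->].
Qed.

Variables (F : col -> R) (d : nat).
Hypotheses (LF : pair_lip F) (degd : forall w, (deg w <= d)%N).
Notation eta := (15 / 1000 / k%:R : R).
Notation U := ((unblocked s t v)%:R : R).
Notation B := (#|[set u | e v u && (blockers s t v u == 1%N)]|%:R : R).
Let xi : R := pair_weight s t v - (F s - F t).

Lemma unblockedE (s' t' : col) :
  (unblocked s' t' v)%:R = \sum_(u in [set u | e v u]) (blockers s' t' v u == 0%N)%:R :> R.
Proof. by rewrite -card_set_sum; congr (_%:R); apply: eq_card => u; rewrite !inE. Qed.

Lemma unblocked_drift : (d + 2 <= k)%N ->
  \sum_(i | common i) fweight s i * (U - (unblocked (flip s i.1 i.2) (flip t i.1 i.2) v)%:R)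
  <= 2 * d%:R * U - (k%:R - 2 - d%:R) * B.
Proof.
move=> dk; have -> : B = \sum_(u in [set u | e v u]) (blockers s t v u == 1%N)%:R.
  by rewrite -card_set_sum; congr (_%:R); apply: eq_card => u; rewrite !inE.
rewrite unblockedE !mulr_sumr -sumrB.
under eq_bigr => i _ do rewrite unblockedE -sumrB mulr_sumr.
rewrite exchange_big /=; apply: ler_sum => u _.
have w0 i : 0 <= fweight s i by have /andP[] := fweightP s i.
have degR w : (deg w)%:R <= d%:R :> R by rewrite ler_nat.
have [b0|b0] := eqVneq (blockers s t v u) 0%N.
  rewrite b0 /= mulr0 subr0 mulr1; apply: le_trans (blocking_rate b0) _.
  by have := degR u; lra.
rewrite mulr0 add0r; have [b1|b1] := eqVneq (blockers s t v u) 1%N.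
  have [w Hw] := unblocking_rate b1; have := degR w; rewrite mulr1.
  under eq_bigr => i _ do rewrite sub0r mulrN.
  by rewrite sumrN; lra.
rewrite mulr0 oppr0; apply: sumr_le0 => i _.
by rewrite sub0r mulr_ge0_le0 // oppr_le0 ler0n.
Qed.

Lemma common_drift : (d + 2 <= k)%N -> 0 <= xi ->
  \sum_(i | common i) fweight s i *
    ((F (flip s i.1 i.2) - F s) - (F (flip t i.1 i.2) - F t)) <=
  #|T|%:R * k%:R * xi + eta * (2 * d%:R * U - (k%:R - 2 - d%:R) * B).
Proof.
move=> dk xi0; have eta0 : 0 <= eta by rewrite divr_ge0 ?ler0n //; lra.
apply: (@le_trans _ _ (\sum_(i | common i) (fweight s i * xi + eta * (fweight s i *
   (U - (unblocked (flip s i.1 i.2) (flip t i.1 i.2) v)%:R))))).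
  apply: ler_sum => i /andP[vs vt]; have /andP[w0 _] := fweightP s i.
  have [ag sv tv] := common_flip st vs vt.
  have := LF ag; rewrite sv tv => /(_ stv); rewrite {1}/pair_weight => H.
  have {}H : (F (flip s i.1 i.2) - F s) - (F (flip t i.1 i.2) - F t) <=
    xi + eta * (U - (unblocked (flip s i.1 i.2) (flip t i.1 i.2) v)%:R).
    by rewrite /xi /pair_weight; lra.
  apply: le_trans (ler_wpM2l w0 H) _; rewrite mulrDr; lra.
rewrite big_split /= -mulr_suml -mulr_sumr lerD ?ler_wpM2l ?unblocked_drift //.
rewrite ler_wpM2r //; apply: (@le_trans _ _ (\sum_(i : T * 'I_k) 1)).
  rewrite big_mkcond; apply: ler_sum => i _; have /andP[w0 w1] := fweightP s i.
  by case: ifP => _ //; rewrite ler01.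
by rewrite sumr_const card_prod card_ord natrM.
Qed.

Lemma gen_contract : (d + 2 <= k)%N -> (11 / 6 - 94 / 10 ^+ 6) * d%:R <= k%:R :> R ->
  (0 < #|T|)%N -> 0 <= xi ->
  gen e F s - gen e F t <= 5 * #|T|%:R * k%:R * xi - k%:R / 10000.
Proof.
move=> dk dkR n0 xi0; rewrite (gen_diff esym F st).
have := common_drift dk xi0; set S := \sum_(i | _) _; move=> HS.
set h : R := 1 - (F s - F t).
have k0 : 0 < k%:R :> R by rewrite ltr0n; apply: leq_trans dk; rewrite addnC.
have hE : h = xi + eta * U by rewrite /h /xi /pair_weight; ring.
have eta0 : 0 <= eta by rewrite divr_ge0 ?ler0n //; lra.
have h0 : 0 <= h by rewrite hE addr_ge0 // mulr_ge0 ?ler0n.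
have HF := lip_hlip LF.
have HC : \sum_c (vdrift e F s t v c - vdrift e F t s v c) <=
  1832 / 1000 * (deg v)%:R - k%:R - 9 / 100 * U + 25 / 10000 * B
  + (2 * k%:R + 2 * (deg v)%:R) * h.
  apply: (le_trans (ler_sum _ (fun c _ => color_cost_all c HF st stv h0))).
  rewrite -/h !big_split /= !sumrN -!mulr_sumr -mulr_suml big_split /= -mulr_sumr.
  rewrite !sum_nbrs !sumr_const !card_ord.
  have := sum_nbrs xpredT s v; rewrite (eq_bigr (fun c => #|nbrs s v c|%:R)); last first.
    by move=> c _; congr (_%:R); apply: eq_card => u; rewrite inE andbT.
  move=> ->; rewrite (_ : [set u | e v u && true] = [set u | e v u]); last first.
    by apply/setP=> u; rewrite !inE andbT.
  rewrite -[2 *+ k]mulr_natr; rewrite /unblocked; lra.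
have dv : (deg v)%:R <= d%:R :> R by rewrite ler_nat.
have Uv : U <= (deg v)%:R.
  by rewrite ler_nat; apply/subset_leq_card/subsetP => u; rewrite !inE => /andP[].
have Bv : B <= (deg v)%:R.
  by rewrite ler_nat; apply/subset_leq_card/subsetP => u; rewrite !inE => /andP[].
have U0 : 0 <= U by rewrite ler0n.
have B0 : 0 <= B by rewrite ler0n.
have nR : 1 <= #|T|%:R :> R by rewrite ler1n.
have small := degree_slack dk dkR _ dv; have {small} := small B; rewrite B0 Bv => /(_ isT) small.
have [h4 U2] := weight_slack dk dv U0 xi0 nR.
rewrite -hE in h4; rewrite (mulrBr (15 / 1000 / k%:R)) in HS.
have -> : 5 * #|T|%:R * k%:R * xi = 5 * (#|T|%:R * k%:R * xi) by rewrite !mulrA.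
exact: drift_sum HS U2 h4 HC small.
Qed.

End Pair.
End Contraction.

(** * Poincare inequality for the flip dynamics *)

Lemma sqr_sum_le (R : realFieldType) (I : finType) (P : pred I) (f g : I -> R) :
  (\sum_(i | P i) f i * g i) ^+ 2 <=
  (\sum_(i | P i) f i ^+ 2) * (\sum_(i | P i) g i ^+ 2).
Proof.
set a := \sum_(i | P i) f i ^+ 2; set b := \sum_(i | P i) f i * g i.
set c := \sum_(i | P i) g i ^+ 2.
have : 0 <= \sum_(i | P i) \sum_(j | P j) (f i * g j - f j * g i) ^+ 2.
  by apply: sumr_ge0 => i _; apply: sumr_ge0 => j _; apply: sqr_ge0.
have -> : \sum_(i | P i) \sum_(j | P j) (f i * g j - f j * g i) ^+ 2 =
    a * c + a * c - (b * b + b * b).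
  have e1 : a * c = \sum_(i | P i) \sum_(j | P j) f i ^+ 2 * g j ^+ 2 by rewrite big_distrlr.
  have e2 : a * c = \sum_(i | P i) \sum_(j | P j) f j ^+ 2 * g i ^+ 2 by rewrite e1 exchange_big.
  have e3 : b * b = \sum_(i | P i) \sum_(j | P j) f i * g i * (f j * g j) by rewrite big_distrlr.
  rewrite [X in _ = X + _ - _]e1 [X in _ = _ + X - _]e2 e3 -!big_split -sumrB /=.
  apply: eq_bigr => i _; rewrite -!big_split -sumrB /=.
  by apply: eq_bigr => j _; ring.
by rewrite expr2 => H; lra.
Qed.

(* For [b m] the squared norm of the m-th iterate of a self-adjoint operator: a geometric bound
   with any constant already controls the first step. *)
Lemma log_convex_ratio (R : realType) (b : nat -> R) (C r : R) :
  0 < r -> (forall n, 0 <= b n) ->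
  (forall n, b n.+1 ^+ 2 <= b n * b n.+2) -> (forall n, b n <= C * r ^+ n) ->
  b 1%N <= r * b 0%N.
Proof.
move=> r0 b0 bc bC; rewrite leNgt; apply/negP => b1.
have b00 : 0 < b 0%N.
  rewrite lt_neqAle b0 andbT; apply/negP => /eqP b0E.
  have := bc 0%N; rewrite -b0E mul0r => H; move: b1; rewrite -b0E mulr0.
  by rewrite ltNge (_ : b 1%N = 0) ?lexx //; apply/eqP; rewrite -sqrf_eq0 eq_le H sqr_ge0.
pose q := b 1%N / b 0%N; have qr : r < q by rewrite ltr_pdivlMr.
have q0 : 0 < q := lt_trans r0 qr.
have grow n : 0 < b n /\ q * b n <= b n.+1.
  elim: n => [|n [bn qn]]; first by rewrite b00 /q divfK // gt_eqF.
  have bn1 : 0 < b n.+1 by apply: lt_le_trans qn; rewrite mulr_gt0.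
  split=> //; have := bc n; rewrite expr2 => H.
  rewrite -(ler_pM2l bn); apply: le_trans H.
  by rewrite mulrA (mulrC (b n)) ler_pM2r.
have bq n : q ^+ n * b 0%N <= b n.
  elim: n => [|n IH]; first by rewrite mul1r.
  by apply: le_trans (grow n).2; rewrite exprS -mulrA ler_pM2l.
pose y := q / r - 1; have y0 : 0 < y by rewrite subr_gt0 ltr_pdivlMr // mul1r.
have ber n : 1 + n%:R * y <= (q / r) ^+ n.
  elim: n => [|n IH]; first by rewrite mul0r addr0 expr0.
  have yE : q / r = 1 + y by rewrite /y addrC subrK.
  rewrite exprS yE in IH *; apply: (@le_trans _ _ ((1 + y) * (1 + n%:R * y))); last first.
    by rewrite ler_pM2l // addr_gt0.
  have : 0 <= n%:R * y * y by rewrite !mulr_ge0 ?ler0n // ltW.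
  by rewrite -natr1; lra.
have bound n : n%:R * y <= C / b 0%N.
  rewrite ler_pdivlMr //; have := bC n; have := bq n.
  have rn : 0 < r ^+ n by rewrite exprn_gt0.
  move=> H1 H2; have := le_trans H1 H2; rewrite -ler_pdivrMr // => H3.
  apply: le_trans H3; have -> : q ^+ n * b 0%N / r ^+ n = (q / r) ^+ n * b 0%N.
    by rewrite [(q / r) ^+ n]expr_div_n mulrAC.
  by rewrite ler_pM2r //; apply: le_trans (ber n); rewrite lerDr ler01.
have := bound (Num.bound (C / b 0%N / y)).
have Cb : 0 <= C / b 0%N by have := bound 0%N; rewrite mul0r.
have : C / b 0%N / y < (Num.bound (C / b 0%N / y))%:R.
  by apply: archi_boundP; rewrite divr_ge0 // ltW.
rewrite ltr_pdivrMr // => H1 H2.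
by have := lt_le_trans H1 H2; rewrite ltxx.
Qed.

Section Proper.
Variables (T : finType) (e : rel T) (k : nat).
Hypothesis esym : symmetric e.
Notation col := {ffun T -> 'I_k}.
Notation cluster := (cluster e).
Notation flip := (flip e).
Notation proper := (proper_coloring e).
Implicit Types (s t : col) (c : 'I_k) (x y : T).

Lemma proper_coloringP s : reflect (forall x y, e x y -> s x != s y) (proper s).
Proof.
apply: (iffP forallP) => [H x y xy|H x].
  by have /forallP/(_ y)/implyP := H x; apply.
by apply/forallP => y; apply/implyP; apply: H.
Qed.

Lemma flip_root s x c : flip s x c x = c.
Proof. by rewrite flip_in ?cluster_refl // mate_id. Qed.

Lemma flip_proper s x c : proper s -> proper (flip s x c).
Proof.
move/proper_coloringP => sp; apply/proper_coloringP => y z yz.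
wlog yS : y z yz / (y \in cluster s x c) || (z \notin cluster s x c).
  move=> H; have [yS|yS] := boolP (y \in cluster s x c); first by apply: H; rewrite ?yS.
  have [zS|zS] := boolP (z \in cluster s x c); last by apply: H; rewrite ?zS ?orbT.
  by rewrite eq_sym; apply: H; rewrite 1?esym ?zS.
have [zS|zS] := boolP (z \in cluster s x c); rewrite ?zS ?orbF ?orbT in yS.
  by rewrite !flip_in // /mate (inj_eq perm_inj) sp.
have [{}yS|{}yS] := boolP (y \in cluster s x c); last by rewrite !flip_out // sp.
rewrite (flip_out zS) flip_in //; apply: contra zS => /eqP szE.
apply: (cluster_step yS); rewrite /alt yz sp //= (cluster_col yS) -szE.
by case: (mateP yS) => -[_ ->]; rewrite eqxx ?orbT.
Qed.

Lemma alt_flip s x c : proper s ->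
  alt e (flip s x c) c (s x) =2 alt e s (s x) c.
Proof.
move/proper_coloringP => sp y z; rewrite /alt; case yz: (e y z) => //=.
have pres w : w \in cluster s x c -> ((tperm (s x) c (s w) == c) || (tperm (s x) c (s w) == s x)).
  by move=> wS; have := mateP wS; rewrite /mate => -[] [_ ->]; rewrite eqxx ?orbT.
have col w : w \in cluster s x c -> (s w == s x) || (s w == c) by apply: cluster_col.
have [yS|yS] := boolP (y \in cluster s x c); have [zS|zS] := boolP (z \in cluster s x c).
- rewrite !flip_in // /mate (inj_eq perm_inj) (pres _ yS) (pres _ zS).
  by rewrite (col _ yS) (col _ zS).
- rewrite (flip_out zS) (flip_in yS) (col _ yS) sp //= -/(mate s x c y).
  have [szc|szc] := boolP ((s z == s x) || (s z == c)).
    case/negP: zS; apply: (cluster_step yS); rewrite /alt yz sp //= szc andbT.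
    by rewrite (cluster_col yS).
  by rewrite (orbC (s z == c)) (negbTE szc) !andbF.
- rewrite (flip_out yS) (flip_in zS) (col _ zS) sp //= -/(mate s x c z).
  have [syc|syc] := boolP ((s y == s x) || (s y == c)).
    case/negP: yS; apply: (cluster_step zS); rewrite /alt esym yz eq_sym sp //= syc andbT.
    by rewrite (cluster_col zS).
  by rewrite (orbC (s y == c)) (negbTE syc) !andbF.
by rewrite !flip_out // orbC (orbC (s z == c)).
Qed.

Lemma cluster_flip s x c : proper s ->
  cluster (flip s x c) x (s x) = cluster s x c.
Proof.
by move=> sp; apply/setP=> y; rewrite !inE flip_root (eq_connect (alt_flip _ _ sp)).
Qed.

Lemma flipK s x c : proper s -> flip (flip s x c) x (s x) = s.
Proof.
move=> sp; apply/ffunP => y; rewrite [LHS]ffunE cluster_flip // flip_root.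
have [yS|yS] := boolP (y \in _); last by rewrite flip_out.
by rewrite flip_in // /mate tpermC tpermK.
Qed.

Definition flip_move (j : col * (T * 'I_k)) : col * (T * 'I_k) :=
  (flip j.1 j.2.1 j.2.2, (j.2.1, j.1 j.2.1)).

Lemma flip_moveK j : proper j.1 -> flip_move (flip_move j) = j.
Proof. by case: j => s [x c] sp; rewrite /flip_move /= flipK // flip_root. Qed.

Lemma sum_flip_move (R : nmodType) (g : col * (T * 'I_k) -> R) :
  \sum_(j | proper j.1) g (flip_move j) = \sum_(j | proper j.1) g j.
Proof.
apply: sum_invol => j sp; first exact: flip_proper.
exact: flip_moveK.
Qed.

End Proper.

Section Poincare.
Variables (R : realType) (T : finType) (e : rel T) (k : nat).
Hypotheses (esym : symmetric e) (eirr : irreflexive e).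
Notation col := {ffun T -> 'I_k}.
Notation proper := (proper_coloring e).
Implicit Types (s t : col) (F G : col -> R).

Definition inner F G : R := \sum_(s | proper s) F s * G s.

Lemma inner_ge0 F : 0 <= inner F F.
Proof. by apply: sumr_ge0 => s _; rewrite -expr2 sqr_ge0. Qed.

Lemma inner_gen F G : inner G (gen e F) =
  \sum_(j : col * (T * 'I_k) | proper j.1)
    fweight R e j.1 j.2 * (F (flip e j.1 j.2.1 j.2.2) - F j.1) * G j.1.
Proof.
rewrite /inner /gen; under eq_bigr => s _ do rewrite mulr_sumr.
rewrite pair_big /=; apply: eq_big => [j|j _]; first by rewrite andbT.
by rewrite mulrC.
Qed.

Lemma fweight_move (j : col * (T * 'I_k)) : proper j.1 ->
  fweight R e (flip_move e j).1 (flip_move e j).2 = fweight R e j.1 j.2.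
Proof. by move=> sp; rewrite /fweight /= cluster_flip. Qed.

Lemma gen_selfadj F G : inner G (gen e F) = inner F (gen e G).
Proof.
rewrite !inner_gen.
under eq_bigr => j _ do rewrite mulrBr mulrBl.
under [RHS]eq_bigr => j _ do rewrite mulrBr mulrBl.
rewrite !sumrB; congr (_ - _); last by apply: eq_bigr => j _; rewrite -!mulrA (mulrC (F _)).
rewrite -[RHS](sum_flip_move esym) /=; apply: eq_bigr => j sp.
by rewrite fweight_move // flipK // -!mulrA (mulrC (F _)).
Qed.

Lemma dirichlet F : - inner F (gen e F) =
  2^-1 * \sum_(j : col * (T * 'I_k) | proper j.1)
    fweight R e j.1 j.2 * (F (flip e j.1 j.2.1 j.2.2) - F j.1) ^+ 2.
Proof.
pose E (g : col * (T * 'I_k) -> R) := \sum_(j | proper j.1) fweight R e j.1 j.2 * g j.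
have mv g : E (fun j => g (flip_move e j)) = E g.
  rewrite /E -[RHS](sum_flip_move esym); apply: eq_bigr => j sp.
  by rewrite fweight_move.
pose a j := F (flip e j.1 j.2.1 j.2.2); pose b (j : col * (T * 'I_k)) := F j.1.
have aa : E (fun j => a j ^+ 2) = E (fun j => b j ^+ 2) by rewrite -[RHS]mv.
have -> : inner F (gen e F) = E (fun j => a j * b j) - E (fun j => b j ^+ 2).
  rewrite inner_gen /E -sumrB; apply: eq_bigr => j _; rewrite /a /b; ring.
have -> : \sum_(j : col * (T * 'I_k) | proper j.1)
    fweight R e j.1 j.2 * (F (flip e j.1 j.2.1 j.2.2) - F j.1) ^+ 2 =
    E (fun j => a j ^+ 2) + E (fun j => b j ^+ 2) - 2 * E (fun j => a j * b j).
  rewrite /E mulr_sumr -big_split -sumrB /=; apply: eq_bigr => j _; rewrite /a /b; ring.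
rewrite aa; lra.
Qed.

End Poincare.

Lemma sum_norm_bound (R : realFieldType) (I : finType) (F : I -> R) i j :
  F i - F j <= 2 * \sum_l `|F l|.
Proof.
have H l : `|F l| <= \sum_l `|F l| by rewrite (bigD1 l) //= lerDl sumr_ge0.
have := H i; have := H j; have := ler_norm (F i); have := ler_norm (- F j).
by rewrite normrN; lra.
Qed.

Section Gap.
Variables (R : realType) (T : finType) (e : rel T) (k : nat).
Hypotheses (esym : symmetric e) (eirr : irreflexive e).
Notation col := {ffun T -> 'I_k}.
Notation proper := (proper_coloring e).
Implicit Types (s t : col) (F G : col -> R).

Notation d := (max_degree e).
Hypotheses (dk : (d + 2 <= k)%N) (dkR : (11 / 6 - 94 / 10 ^+ 6) * d%:R <= k%:R :> R).
Hypothesis n0 : (0 < #|T|)%N.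
Notation K := (5 * #|T|%:R * k%:R : R).
Definition flip_rate : R := 1 - (50 * 1000 * #|T|%:R)^-1.
Notation rho := flip_rate.

Lemma deg_le_max u : (#|[set w | e u w]| <= d)%N.
Proof. by rewrite /max_degree (bigD1 u) //= leq_maxl. Qed.

Lemma k_gt0 : 0 < k%:R :> R.
Proof. by rewrite ltr0n; apply: leq_trans dk; rewrite addnC. Qed.

Lemma n_ge1 : 1 <= #|T|%:R :> R.
Proof. by rewrite ler1n. Qed.

Lemma K_gt0 : 0 < K.
Proof. by rewrite !mulr_gt0 ?k_gt0 // (lt_le_trans ltr01 n_ge1). Qed.

Lemma rho_gt0 : 0 < rho.
Proof.
have n1 := n_ge1; rewrite /flip_rate subr_gt0 invf_lt1; first by lra.
by lra.
Qed.

Definition flip_step F : col -> R := fun s => F s + gen e F s / K.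

Lemma gen_scale a F s : gen e (fun s => a * F s) s = a * gen e F s.
Proof. by rewrite /gen mulr_sumr; apply: eq_bigr => i _; ring. Qed.

Lemma flip_step_scale a F s : flip_step (fun s => a * F s) s = a * flip_step F s.
Proof. by rewrite /flip_step gen_scale; ring. Qed.

Lemma lip_step F : pair_lip e F -> pair_lip e (fun s => rho^-1 * flip_step F s).
Proof.
move=> LF v s t st stv; rewrite -mulrBr ler_pdivrMl ?rho_gt0 //.
have xi0 : 0 <= pair_weight R e s t v - (F s - F t) by rewrite subr_ge0 LF.
have := gen_contract esym eirr st stv LF deg_le_max dk dkR n0 xi0.
have w1 := pair_weight_le1 R e s t v.
move: (pair_weight R e s t v) w1 xi0 => D D1 xi0 H.
have n1 := n_ge1; have kp := k_gt0; have Kp := K_gt0.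
have -> : flip_step F s - flip_step F t = F s - F t + (gen e F s - gen e F t) / K.
  by rewrite /flip_step; ring.
have {}H : (gen e F s - gen e F t) / K <= D - (F s - F t) - (50 * 1000 * #|T|%:R)^-1.
  rewrite ler_pdivrMr //; apply: le_trans H _.
  rewrite mulrBl (mulrC _ K) lerD2l lerN2 (_ : _^-1 * K = k%:R / 10000) //.
  by field; rewrite gt_eqF // (lt_le_trans ltr01 n1).
have dp : 0 <= (50 * 1000 * #|T|%:R : R)^-1 by rewrite invr_ge0; lra.
have : (50 * 1000 * #|T|%:R : R)^-1 * D <= (50 * 1000 * #|T|%:R)^-1 by rewrite ler_piMr.
by rewrite /flip_rate; lra.
Qed.

Lemma lip_bounded F M : 4 * \sum_s `|F s| <= M -> 0 < M -> pair_lip e (fun s => M^-1 * F s).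
Proof.
move=> HM M0 v s t _ _; rewrite -mulrBr ler_pdivrMl //.
apply: le_trans (sum_norm_bound F s t) _.
have U : (unblocked e s t v <= k)%N.
  apply: (@leq_trans d); last by apply: leq_trans dk; rewrite leq_addr.
  apply: leq_trans (deg_le_max v); apply/subset_leq_card/subsetP => u.
  by rewrite !inE => /andP[].
have : 2^-1 <= pair_weight R e s t v.
  have : 15 / 1000 / k%:R * (unblocked e s t v)%:R <= 15 / 1000 :> R.
    rewrite -mulrA ler_piMr //; first by lra.
    by rewrite mulrC ler_pdivrMr ?k_gt0 // mul1r ler_nat.
  by rewrite /pair_weight; lra.
move=> H; have : M / 2 <= M * pair_weight R e s t v by rewrite ler_pM2l.
by lra.
Qed.

Lemma flip_step_selfadj F G : inner e (flip_step F) G = inner e F (flip_step G).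
Proof.
transitivity (inner e F G + inner e G (gen e F) / K).
  by rewrite /inner mulr_suml -big_split /=; apply: eq_bigr => s _; rewrite /flip_step; ring.
rewrite gen_selfadj // /inner mulr_suml -big_split /=.
by apply: eq_bigr => s _; rewrite /flip_step; ring.
Qed.

Lemma sum_flip_step F : \sum_(s | proper s) flip_step F s = \sum_(s | proper s) F s.
Proof.
have E G : \sum_(s | proper s) G s = inner e (fun=> 1) G.
  by apply: eq_bigr => s _; rewrite mul1r.
rewrite !E -flip_step_selfadj; apply: eq_bigr => s _; congr (_ * _).
rewrite /flip_step /gen big1 ?mul0r ?addr0 // => i _.
by rewrite subrr mulr0.
Qed.

Lemma iter_flip_step_bound F : \sum_(s | proper s) F s = 0 ->
  exists C : R, forall m,
    inner e (iter m flip_step F) (iter m flip_step F) <= C * (rho ^+ 2) ^+ m.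
Proof.
move=> F0; pose M := 4 * \sum_s `|F s| + 1.
have M0 : 0 < M by rewrite ltr_wpDl // mulr_ge0 // sumr_ge0.
have r0 := rho_gt0; have rm m : 0 < rho ^+ m by rewrite exprn_gt0.
have L m : pair_lip e (fun s => (M * rho ^+ m)^-1 * iter m flip_step F s).
  elim: m => [|m /lip_step IH].
    by rewrite expr0 mulr1; apply: lip_bounded => //; rewrite lerDl.
  move=> v s t st stv; apply: le_trans (IH v s t st stv).
  rewrite !flip_step_scale !mulrA -invfM exprS (mulrCA M) mulrC.
  by rewrite (mulrC (rho * _)^-1).
have S m : \sum_(s | proper s) iter m flip_step F s = 0.
  by elim: m => // m IH; rewrite sum_flip_step.
pose N : R := \sum_(s : col | proper s) 1.
have NE (x : R) : N * x = \sum_(s' : col | proper s') x.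
  by rewrite mulr_suml; apply: eq_bigr => s' _; rewrite mul1r.
exists (N * (M * #|T|%:R) ^+ 2) => m.
have bnd s : proper s -> `|iter m flip_step F s| <= M * rho ^+ m * #|T|%:R.
  move=> sp; have Mm : 0 < M * rho ^+ m by rewrite mulr_gt0.
  have N0 : 0 < N by rewrite /N (bigD1 s) //= ltr_wpDr ?ltr01 ?sumr_ge0.
  have diff s1 s2 : iter m flip_step F s1 - iter m flip_step F s2 <= M * rho ^+ m * #|T|%:R.
    rewrite -ler_pdivrMl // mulrBr; have := lip_hlip (L m) (W := setT).
    by rewrite cardsT; apply => x; rewrite inE.
  rewrite -(ler_pM2l N0) [X in _ <= X]NE; set x := iter m flip_step F s.
  have -> : N * `|x| = `|\sum_(s' | proper s') (x - iter m flip_step F s')|.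
    by rewrite sumrB S subr0 -NE normrM ger0_norm // ltW.
  apply: le_trans (ler_norm_sum _ _ _) _; apply: ler_sum => s' _.
  by rewrite ler_norml diff andbT lerNl opprB diff.
have -> : N * (M * #|T|%:R) ^+ 2 * (rho ^+ 2) ^+ m =
    \sum_(s : col | proper s) (M * rho ^+ m * #|T|%:R) ^+ 2.
  by rewrite -NE exprAC; ring.
apply: ler_sum => s /bnd H; rewrite -expr2 -real_normK ?num_real //.
by rewrite lerXn2r // ?nnegrE // (le_trans _ H).
Qed.

Lemma flip_gap F : \sum_(s | proper s) F s = 0 ->
  k%:R / 10000 * inner e F F <= - inner e F (gen e F).
Proof.
move=> F0; have r0 := rho_gt0; have [C HC] := iter_flip_step_bound F0.
pose b m := inner e (iter m flip_step F) (iter m flip_step F).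
have b1 : b 1%N <= rho ^+ 2 * b 0%N.
  apply: log_convex_ratio HC; first by rewrite exprn_gt0.
    by move=> m; apply: inner_ge0.
  move=> m; rewrite /b.
  have -> : inner e (iter m.+1 flip_step F) (iter m.+1 flip_step F) =
     inner e (iter m flip_step F) (iter m.+2 flip_step F) by rewrite [LHS]flip_step_selfadj.
  apply: le_trans (sqr_sum_le _ _ _) _.
  by under eq_bigr do rewrite expr2; under [X in _ * X]eq_bigr do rewrite expr2.
have amgm : 2 * inner e F (flip_step F) <= rho * b 0%N + rho^-1 * b 1%N.
  rewrite /b /inner !mulr_sumr -big_split /=; apply: ler_sum => s _.
  rewrite -subr_ge0 (_ : _ - _ = rho^-1 * (rho * F s - flip_step F s) ^+ 2).
    by rewrite mulr_ge0 ?sqr_ge0 // invr_ge0 ltW.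
  by move: (flip_step F s) => x; field; rewrite gt_eqF.
have b1' : rho^-1 * b 1%N <= rho * b 0%N.
  by rewrite ler_pdivrMl // mulrA -expr2.
have E : inner e F (flip_step F) = b 0%N + inner e F (gen e F) / K.
  by rewrite /b /inner mulr_suml -big_split /=; apply: eq_bigr => s _; rewrite /flip_step; ring.
have H : inner e F (gen e F) / K <= - (50 * 1000 * #|T|%:R)^-1 * b 0%N.
  by move: amgm b1'; rewrite E /flip_rate; lra.
rewrite ler_pdivrMr ?K_gt0 // in H.
rewrite lerNr; apply: le_trans H _.
rewrite mulrAC mulNr (_ : _^-1 * K = k%:R / 10000) ?mulNr //.
by field; rewrite gt_eqF // (lt_le_trans ltr01 n_ge1).
Qed.

End Gap.

Definition avoid (T : eqType) (r : rel T) w : rel T := fun a b => [&& r a b, a != w & b != w].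

(** * Comparison with single-site recolouring *)

Lemma connect_min (T : finType) (r : rel T) (A : {set T}) x z :
  connect r x z -> x \in A -> (forall a b, a \in A -> r a b -> b \in A) -> z \in A.
Proof.
move=> /connectP[q] + + xA clA; elim: q x xA => [|a q IH] x xA /=; first by move=> _ ->.
by move=> /andP[xa qa]; apply: IH qa; apply: clA xa.
Qed.

(* A pair [w, y] maximizing the component of [y] in [S] minus [w] works: a missed vertex [z]
   would give the larger component of [y] in [S] minus [z]. *)
Lemma noncut_vertex (T : finType) (r : rel T) (S : {set T}) : symmetric r ->
  (forall x y, x \in S -> r x y -> y \in S) ->
  {in S &, forall x y, connect r x y} -> (1 < #|S|)%N ->
  exists2 w, w \in S & {in S &, forall y z, y != w -> z != w -> connect (avoid r w) y z}.
Proof.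
move=> rsym Sr Sc S2.
pose K (j : T * T) := [set z | connect (avoid r j.1) j.2 z].
pose P (j : T * T) := [&& j.1 \in S, j.2 \in S & j.1 != j.2].
have KP j z : P j -> z \in K j -> (z \in S) && (z != j.1).
  move=> /and3P[_ yS wy]; rewrite inE => /(@connect_min _ _ (S :\ j.1)) H.
  rewrite andbC -in_setD1; apply: H; first by rewrite in_setD1 yS eq_sym wy.
  by move=> a b; rewrite !in_setD1 => /andP[_ aS] /and3P[ab _ ->]; apply: Sr ab.
have [x xS [y yS xy]] : exists2 x, x \in S & exists2 y, y \in S & x != y.
  have /card_gt0P[x xS] : (0 < #|S|)%N by apply: ltnW.
  have /card_gt0P[y] : (0 < #|S :\ x|)%N by have := cardsD1 x S; rewrite xS; lia.
  by rewrite in_setD1 => /andP[yx yS]; exists x => //; exists y; rewrite // eq_sym.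
have P0 : P (x, y) by rewrite /P xS yS.
case: (@arg_maxnP _ (x, y) P (fun j => #|K j|) P0) => -[w u] Pwu Kmax.
have /and3P[/= wS uS wu] := Pwu.
have uK : u \in K (w, u) by rewrite inE connect0.
have step a b : a \in K (w, u) -> r a b -> b != w -> b \in K (w, u).
  move=> aK ab bw; have /andP[_ aw] := KP _ _ Pwu aK; move: aK; rewrite !inE => ua.
  by apply: connect_trans ua (connect1 _); rewrite /avoid ab aw.
have all_in z : z \in S -> z != w -> z \in K (w, u).
  move=> zS zw; apply/negPn/negP => zK.
  have zu : z != u by apply: contraNneq zK => ->.
  have Pz : P (z, u) by rewrite /P zS uS.
  have inKz a b : a \in K (w, u) -> a \in K (z, u) -> r a b -> b != z -> b \in K (z, u).
    move=> aK; rewrite !inE /= => ua ab bz; apply: connect_trans ua (connect1 _).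
    by rewrite /avoid ab bz andbT; apply: contraNneq zK => <-.
  have uz : u \in K (z, u) by rewrite inE connect0.
  have sub a : a \in K (w, u) -> a \in K (z, u).
    rewrite {1}inE => /(@connect_min _ _ (K (w, u) :&: K (z, u))) H.
    suff: a \in K (w, u) :&: K (z, u) by rewrite in_setI => /andP[].
    apply: H; first by rewrite in_setI uK uz.
    move=> {}a b; rewrite !in_setI => /andP[aK az] /and3P[ab _ bw].
    have bK := step _ _ aK ab bw; rewrite bK /=; apply: (inKz _ _ aK az ab).
    by apply: contraNneq zK => <-.
  have wK : w \notin K (w, u) by apply/negP => /(KP _ _ Pwu) /=; rewrite eqxx andbF.
  have [a aK aw] : exists2 a, a \in K (w, u) & r a w.
    apply/exists_inP; case: (boolP [exists a in _, _]) => // /exists_inPn noadj.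
    case/negP: wK; apply: (connect_min (Sc u w uS wS) uK) => a b aK ab.
    by apply: (step _ _ aK ab); apply: contraTneq ab => ->; apply: noadj.
  have := Kmax _ Pz; rewrite /= leqNgt => /negP[]; apply: proper_card.
  apply/properP; split; first by apply/subsetP.
  by exists w => //; apply: (inKz _ _ aK (sub _ aK) aw); rewrite eq_sym.
exists w => // y' z y'S zS /(all_in _ y'S) y'K /(all_in _ zS) zK.
have csym : connect_sym (avoid r w).
  by apply: sym_connect_sym => a b; rewrite /avoid rsym (andbC (a != w)).
by move: y'K zK; rewrite !inE /= csym => uy; apply: connect_trans.
Qed.

Section Comparison.
Variables (R : realType) (T : finType) (e : rel T) (k : nat).
Hypotheses (esym : symmetric e) (eirr : irreflexive e).
Notation col := {ffun T -> 'I_k}.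
Notation proper := (proper_coloring e).
Notation cluster := (cluster e).
Notation flip := (flip e).
Implicit Types (s t : col) (c : 'I_k) (w x y : T).

Definition recolor s x c : col := [ffun y => if y == x then c else s y].

Lemma availP s x c : reflect (forall u, e x u -> s u != c) (c \in avail e s x).
Proof.
rewrite inE; apply: (iffP forallP) => H u; first by move=> xu; have /implyP := H u; apply.
by apply/implyP; apply: H.
Qed.

Lemma recolor_proper s x c : proper s -> c \in avail e s x -> proper (recolor s x c).
Proof.
move=> /proper_coloringP sp /availP sc; apply/proper_coloringP => y z yz; rewrite !ffunE.
case: (eqVneq y x) (eqVneq z x) => [yx|_] [zx|_]; last exact: sp.
- by rewrite yx zx eirr in yz.
- by rewrite eq_sym sc // -yx.
by rewrite sc // -zx esym.
Qed.

Lemma recolor_back s x c : proper s -> s x \in avail e (recolor s x c) x.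
Proof.
move=> /proper_coloringP sp; apply/availP => u xu; rewrite ffunE.
by case: (eqVneq u x) xu => [->|_ xu]; rewrite ?eirr // eq_sym sp.
Qed.

Lemma recolorK s x c : recolor (recolor s x c) x (s x) = s.
Proof. by apply/ffunP => y; rewrite !ffunE; case: (eqVneq y x) => [->|]. Qed.

Lemma sum_recolor x (g : col -> 'I_k -> R) :
  \sum_(s | proper s) \sum_(c in avail e s x) g (recolor s x c) (s x) =
  \sum_(s | proper s) \sum_(c in avail e s x) g s c.
Proof.
rewrite !pair_big_dep /=.
pose J (j : col * 'I_k) := (recolor j.1 x j.2, j.1 x).
rewrite -(@sum_invol _ _ _ J (fun j => g j.1 j.2)) //= => [[s c]|[s c]] /= /andP[sp sc].
  by rewrite recolor_proper // recolor_back.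
by rewrite /J /= recolorK ffunE eqxx.
Qed.

Lemma cluster_neq1 s w c : (1 < #|cluster s w c|)%N ->
  c != s w /\ exists2 y, e w y & s y = c.
Proof.
move=> S2; have cw : c != s w.
  by apply: contraTneq S2 => ->; rewrite cluster_self cards1.
split=> //; have [/existsP[y /andP[wy /eqP sy]]|] := boolP [exists y, e w y && (s y == c)].
  by exists y.
rewrite negb_exists => /forallP H; suff S1 : cluster s w c \subset [set w].
  by have := subset_leq_card S1; rewrite cards1 leqNgt S2.
apply: cluster_min => [|y z]; rewrite !in_set1 // => /eqP -> /and4P[wz nz _].
have := H z; rewrite wz /= => /negbTE ->.
by rewrite eq_sym (negbTE nz).
Qed.

Definition noncut s w c :=
  [forall y in cluster s w c, forall z in cluster s w c,
    (y != w) ==> (z != w) ==> connect (avoid (alt e s (s w) c) w) y z].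

Lemma noncut_exists s x c : (1 < #|cluster s x c|)%N ->
  exists2 j, j \in mates e s (x, c) & noncut s j.1 j.2.
Proof.
move=> S2; pose r := alt e s (s x) c.
have [||w wS H] := @noncut_vertex _ r (cluster s x c) (alt_sym esym _ _ _) _ _ S2.
- by move=> y z; apply: cluster_step.
- move=> y z; rewrite !inE => xy xz; apply: connect_trans xz.
  by rewrite (alt_csym esym).
exists (w, mate s x c w); first by rewrite inE wS eqxx.
apply/forall_inP => y /=; rewrite cluster_mate // => yS; apply/forall_inP => z zS.
apply/implyP => yw; apply/implyP => zw; have := H y z yS zS yw zw.
by congr is_true; apply: eq_connect => a b; rewrite /avoid alt_mate.
Qed.

Lemma cluster_recolor s w c c0 y : (1 < #|cluster s w c|)%N -> noncut s w c ->
  c0 != s w -> c0 != c -> e w y -> s y = c ->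
  cluster (recolor s w c0) y (s w) = cluster s w c :\ w.
Proof.
move=> S2 nc c0w c0c wy sy; have [cw _] := cluster_neq1 S2.
have yw : y != w by apply: contraNneq cw => <-; rewrite sy.
have ys : recolor s w c0 y = c by rewrite ffunE (negbTE yw) sy.
have yS : y \in cluster s w c by apply: cluster_nbr.
apply/eqP; rewrite eqEsubset; apply/andP; split.
  apply: cluster_min => [|a b]; rewrite !in_setD1; first by rewrite yw yS.
  rewrite ys => /andP[aw aS] /and4P[ab]; rewrite !ffunE (negbTE aw).
  case: (eqVneq b w) => [-> _ _|bw]; first by rewrite (negbTE c0c) (negbTE c0w).
  move=> nab sa sb /=; apply: (cluster_step aS).
  by rewrite /alt ab nab orbC sa orbC sb.
apply/subsetP => z; rewrite in_setD1 => /andP[zw zS].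
have /forall_inP/(_ y yS)/forall_inP/(_ z zS) := nc.
rewrite yw zw /= inE ys; apply: connect_sub => a b /and3P[/and4P[ab nab sa sb] aw bw].
apply: connect1; rewrite /alt ab !ffunE (negbTE aw) (negbTE bw) nab /=.
by rewrite orbC sa orbC sb.
Qed.

Lemma flip_recolor s w c c0 y : (1 < #|cluster s w c|)%N -> noncut s w c ->
  c0 != s w -> c0 != c -> e w y -> s y = c ->
  flip (recolor s w c0) y (s w) = recolor (flip s w c) w c0.
Proof.
move=> S2 nc c0w c0c wy sy; have [cw _] := cluster_neq1 S2.
have yw : y != w by apply: contraNneq cw => <-; rewrite sy.
apply/ffunP => x; rewrite [LHS]ffunE (cluster_recolor S2 nc c0w c0c wy sy) [RHS]ffunE in_setD1.
rewrite !ffunE (negbTE yw) sy; case: (eqVneq x w) => [-> //|xw] /=.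
by rewrite tpermC.
Qed.

Lemma card_avail s w : (k <= #|avail e s w| + #|[set u | e w u]|)%N.
Proof.
rewrite -[X in (X <= _)%N]card_ord -(cardsC (avail e s w)) leq_add2l.
apply: leq_trans (leq_imset_card s _); apply/subset_leq_card/subsetP => c.
rewrite inE => /availP cN; apply/imsetP.
have [/existsP[u /andP[wu /eqP su]]|] := boolP [exists u, e w u && (s u == c)].
  by exists u; rewrite ?inE.
rewrite negb_exists => /forallP H; case: cN => u wu.
by have := H u; rewrite wu.
Qed.

Lemma avail_flip s w c c0 : (1 < #|cluster s w c|)%N ->
  c0 \in avail e s w -> c0 != s w -> c0 \in avail e (flip s w c) w.
Proof.
move=> S2 /availP c0N c0w; have [cw [y wy sy]] := cluster_neq1 S2.
have c0c : c0 != c by rewrite eq_sym -sy c0N.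
apply/availP => u wu; have [uS|uS] := boolP (u \in cluster s w c).
  by rewrite flip_in //; case: (mateP uS) => -[_ ->]; rewrite eq_sym.
by rewrite flip_out // c0N.
Qed.

Variable f : col -> R.

Definition site_form : R :=
  \sum_(s | proper s) \sum_x \sum_(c in avail e s x) (f (recolor s x c) - f s) ^+ 2.
Definition flip_form (l : nat) : R :=
  \sum_(s | proper s) \sum_(j : T * 'I_k) (#|cluster s j.1 j.2| == l)%:R *
    (f (flip s j.1 j.2) - f s) ^+ 2.

Lemma site_form_ge0 : 0 <= site_form.
Proof. by do 3 (apply: sumr_ge0 => ? _); apply: sqr_ge0. Qed.

Lemma flip_form0 : flip_form 0 = 0.
Proof.
apply: big1 => s _; apply: big1 => j _; case: eqP => [/cards0_eq E|_]; last by rewrite mul0r.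
by have := cluster_refl e s j.1 j.2; rewrite E in_set0.
Qed.

Lemma flip_form1 : flip_form 1 <= site_form.
Proof.
apply: ler_sum => s _; rewrite -(pair_big xpredT xpredT
  (fun x c => (#|cluster s x c| == 1%N)%:R * (f (flip s x c) - f s) ^+ 2)) /=.
apply: ler_sum => x _; rewrite [X in _ <= X]big_mkcond /=; apply: ler_sum => c _.
have [c1|_] := eqVneq #|cluster s x c| 1%N; last first.
  by rewrite mul0r; case: ifP => _ //; apply: sqr_ge0.
rewrite mul1r; have [->|cx] := eqVneq c (s x).
  by rewrite flip_self subrr expr0n; case: ifP => _; rewrite ?sqr_ge0.
have cl : cluster s x c = [set x].
  have /eqP/cards1P[y E] := c1; have := cluster_refl e s x c; rewrite E in_set1 => /eqP ->.
  by [].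
have -> : c \in avail e s x.
  apply/availP => u xu; apply/eqP => su; have := cluster_nbr xu su cx.
  by rewrite cl in_set1 => /eqP ux; rewrite ux eirr in xu.
suff -> : flip s x c = recolor s x c by [].
apply/ffunP => y; rewrite !ffunE cl in_set1; case: eqP => [->|//].
by rewrite tpermL.
Qed.

Definition noncut_form (l : nat) : R :=
  \sum_(s | proper s) \sum_(j : T * 'I_k | (#|cluster s j.1 j.2| == l) && noncut s j.1 j.2)
    (f (flip s j.1 j.2) - f s) ^+ 2.

Lemma flip_form_noncut l : (1 < l)%N -> flip_form l <= l%:R * noncut_form l.
Proof.
move=> l1; rewrite /flip_form /noncut_form mulr_sumr; apply: ler_sum => s _.
pose Q (j : T * 'I_k) := #|cluster s j.1 j.2| == l.
pose G (j : T * 'I_k) : R := l%:R * (f (flip s j.1 j.2) - f s) ^+ 2.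
have l0 : l%:R != 0 :> R by rewrite pnatr_eq0 -lt0n; apply: ltnW.
have -> : \sum_(j : T * 'I_k) (#|cluster s j.1 j.2| == l)%:R *
    (f (flip s j.1 j.2) - f s) ^+ 2 = \sum_(j | Q j) G j / #|mates e s j|%:R.
  rewrite [RHS]big_mkcond; apply: eq_bigr => j _; rewrite /Q card_mates.
  by case: eqP => [->|_]; rewrite ?mul0r // mul1r /G mulrC mulrA mulVf // mul1r.
rewrite (@sum_frac _ _ (mates e s) Q (fun j => noncut s j.1 j.2)); first last.
- by move=> [x c] /eqP /= E; apply: noncut_exists; rewrite E.
- by move=> i j Qi /(matesE esym) [e1 e2 e3]; rewrite /Q /G e1 e2 e3; split.
- by move=> i _; apply: mates_refl.
rewrite mulr_sumr; apply: ler_sum => j /andP[_ nj].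
have G0 : 0 <= G j by rewrite mulr_ge0 ?ler0n ?sqr_ge0.
have c0 : (0 < #|[set i in mates e s j | noncut s i.1 i.2]|)%N.
  by apply/card_gt0P; exists j; rewrite inE mates_refl nj.
by have /andP[] := ge0_div_le G0 c0.
Qed.

Definition site_energy s w : R := \sum_(c in avail e s w) (f (recolor s w c) - f s) ^+ 2.
Definition flip_energy l s y c : R :=
  (#|cluster s y c| == l)%:R * (f (flip s y c) - f s) ^+ 2.
Definition mid_energy l s w c : R :=
  \sum_(y | e w y && (s y == c)) \sum_(c0 in avail e s w)
    flip_energy l (recolor s w c0) y (s w).

Lemma flip_energy_ge0 l s y c : 0 <= flip_energy l s y c.
Proof. by rewrite mulr_ge0 ?ler0n ?sqr_ge0. Qed.

Hypothesis spare : forall s w, (k <= 5 * #|avail e s w :\ s w|)%N.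
Hypothesis degk : forall w, (#|[set u | e w u]| <= k)%N.
Hypothesis k0 : (0 < k)%N.

(* Telescope along: recolour [w] to a spare colour, flip the rest of the cluster,
   give [w] its final colour; average over the spare colours. *)
Lemma noncut_energy l s w c : #|cluster s w c| = l.+2 -> noncut s w c ->
  (f (flip s w c) - f s) ^+ 2 <= 15 / k%:R *
    (site_energy (flip s w c) w + mid_energy l.+1 s w c + site_energy s w).
Proof.
move=> Sl nc; have S2 : (1 < #|cluster s w c|)%N by rewrite Sl.
have [cw [y wy sy]] := cluster_neq1 S2.
set C0 := avail e s w :\ s w; set D := (f _ - f s) ^+ 2.
have kp : 0 < k%:R :> R by rewrite ltr0n.
have D0 : 0 <= D by apply: sqr_ge0.
have H : #|C0|%:R * D <= 3 * (site_energy (flip s w c) w + mid_energy l.+1 s w c + site_energy s w).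
  have sub (B : {set 'I_k}) (g : 'I_k -> R) : {subset C0 <= B} -> (forall c, 0 <= g c) ->
      \sum_(c in C0) g c <= \sum_(c in B) g c.
    move=> CB g0; rewrite big_mkcond [X in _ <= X]big_mkcond; apply: ler_sum => c0 _.
    by case: ifP => [/CB -> //|_]; case: ifP.
  have g1 : \sum_(c0 in C0) (f (recolor (flip s w c) w c0) - f (flip s w c)) ^+ 2 <=
      site_energy (flip s w c) w.
    apply: sub => [c0|c0]; last exact: sqr_ge0.
    by rewrite in_setD1 => /andP[c0w c0a]; apply: avail_flip.
  have g3 : \sum_(c0 in C0) (f (recolor s w c0) - f s) ^+ 2 <= site_energy s w.
    apply: sub => [c0|c0]; last exact: sqr_ge0.
    by rewrite in_setD1 => /andP[].
  have g2 : \sum_(c0 in C0) flip_energy l.+1 (recolor s w c0) y (s w) <= mid_energy l.+1 s w c.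
    apply: (@le_trans _ _ (\sum_(c0 in avail e s w) flip_energy l.+1 (recolor s w c0) y (s w))).
      apply: sub => [c0|c0]; last exact: flip_energy_ge0.
      by rewrite in_setD1 => /andP[].
    rewrite /mid_energy (bigD1 y) ?wy ?sy ?eqxx //= lerDl.
    by do 2 (apply: sumr_ge0 => ? _); apply: flip_energy_ge0.
  apply: le_trans (ler_wpM2l _ (lerD (lerD g1 g2) g3)); last by [].
  rewrite -!big_split /= mulr_sumr mulr_natl -sumr_const; apply: ler_sum => c0.
  rewrite in_setD1 => /andP[c0w /availP c0N].
  have c0c : c0 != c by rewrite eq_sym -sy c0N.
  rewrite /flip_energy (cluster_recolor S2 nc c0w c0c wy sy) (flip_recolor S2 nc c0w c0c wy sy).
  have -> : #|cluster s w c :\ w| = l.+1.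
    by have := cardsD1 w (cluster s w c); rewrite cluster_refl Sl => -[].
  rewrite eqxx mul1r /D.
  move: (f (flip s w c)) (f (recolor (flip s w c) w c0)) (f (recolor s w c0)) (f s) => x1 x2 x3 x4.
  have e1 := sqr_ge0 ((x2 - x1) + (x2 - x3)); have e2 := sqr_ge0 ((x2 - x3) - (x3 - x4)).
  by have e3 := sqr_ge0 ((x2 - x1) + (x3 - x4)); nra.
rewrite mulrAC ler_pdivlMr // mulrC.
have : k%:R <= 5 * #|C0|%:R :> R by rewrite -natrM ler_nat spare.
move=> kC; apply: le_trans (ler_wpM2r D0 kC) _.
by rewrite -mulrA; lra.
Qed.

Lemma sum_triple (g : col -> T * 'I_k -> R) :
  \sum_(j : col * (T * 'I_k) | proper j.1) g j.1 j.2 = \sum_(s | proper s) \sum_j g s j.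
Proof. by rewrite pair_big_dep; apply: eq_bigl => j; rewrite andbT. Qed.

Lemma sum_site_energy :
  \sum_(j : col * (T * 'I_k) | proper j.1) site_energy j.1 j.2.1 = k%:R * site_form.
Proof.
rewrite /site_form mulr_sumr (sum_triple (fun s j => site_energy s j.1)) /=.
apply: eq_bigr => s _; rewrite -(pair_big xpredT xpredT (fun w c => site_energy s w)) /=.
rewrite mulr_sumr; apply: eq_bigr => w _.
by rewrite sumr_const card_ord mulr_natl.
Qed.

Lemma sum_mid_energy l :
  \sum_(j : col * (T * 'I_k) | proper j.1) mid_energy l j.1 j.2.1 j.2.2 <= k%:R * flip_form l.
Proof.
rewrite (sum_triple (fun s j => mid_energy l s j.1 j.2)) /=.
have -> : \sum_(s | proper s) \sum_(j : T * 'I_k) mid_energy l s j.1 j.2 =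
  \sum_w \sum_(y | e w y) \sum_(s | proper s) \sum_(c0 in avail e s w)
     flip_energy l (recolor s w c0) y (s w).
  under eq_bigr => s _ do rewrite -(pair_big xpredT xpredT (fun w c => mid_energy l s w c)) /=.
  rewrite exchange_big /=; apply: eq_bigr => w _; rewrite [RHS]exchange_big /=.
  apply: eq_bigr => s _; rewrite [RHS](partition_big (fun y => s y) predT) //=; apply: eq_bigr => c _.
have -> : k%:R * flip_form l = \sum_y \sum_(s | proper s) \sum_c k%:R * flip_energy l s y c.
  rewrite exchange_big /flip_form mulr_sumr; apply: eq_bigr => s _.
  rewrite -(pair_big xpredT xpredT (fun y c => flip_energy l s y c)) /= mulr_sumr.
  by apply: eq_bigr => y _; rewrite mulr_sumr.
rewrite (exchange_big_dep predT) //=; apply: ler_sum => y _.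
apply: (@le_trans _ _ (\sum_(w | e w y) \sum_(s | proper s) \sum_c flip_energy l s y c)).
  apply: ler_sum => w _; rewrite (sum_recolor w (fun s c => flip_energy l s y c)).
  apply: ler_sum => s _; rewrite big_mkcond; apply: ler_sum => c _.
  by case: ifP => _ //; apply: flip_energy_ge0.
under [X in _ <= X]eq_bigr do rewrite -mulr_sumr.
rewrite -mulr_sumr sumr_const -[X in X <= _]mulr_natl ler_wpM2r //.
  by do 2 (apply: sumr_ge0 => ? _); apply: flip_energy_ge0.
rewrite ler_nat; apply: leq_trans (degk y); apply/subset_leq_card/subsetP => w.
by rewrite inE esym.
Qed.

Lemma noncut_form_le l : noncut_form l.+2 <= 15 * (2 * site_form + flip_form l.+1).
Proof.
have kp : 0 < k%:R :> R by rewrite ltr0n.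
apply: (@le_trans _ _ (15 / k%:R * \sum_(j : col * (T * 'I_k) | proper j.1)
   (site_energy (flip j.1 j.2.1 j.2.2) j.2.1 + mid_energy l.+1 j.1 j.2.1 j.2.2 +
    site_energy j.1 j.2.1))).
  rewrite (sum_triple (fun s j => site_energy (flip s j.1 j.2) j.1 +
     mid_energy l.+1 s j.1 j.2 + site_energy s j.1)) /=.
  rewrite mulr_sumr; apply: ler_sum => s _; rewrite mulr_sumr big_mkcond; apply: ler_sum => j _.
  case: ifP => [/andP[/eqP Sl nc]|_]; first exact: noncut_energy.
  rewrite mulr_ge0 ?divr_ge0 ?ler0n ?(ltW kp) // !addr_ge0 ?sumr_ge0 // => [c _|y _|c _].
  - exact: sqr_ge0.
  - by apply: sumr_ge0 => c _; apply: flip_energy_ge0.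
  exact: sqr_ge0.
rewrite !big_split /= sum_site_energy.
have -> : \sum_(j : col * (T * 'I_k) | proper j.1)
    site_energy (flip j.1 j.2.1 j.2.2) j.2.1 = k%:R * site_form.
  by rewrite -sum_site_energy -[RHS](sum_flip_move esym).
have := sum_mid_energy l.+1 => H.
rewrite mulrAC ler_pdivrMr // -mulrA ler_pM2l //.
by move: H; lra.
Qed.

End Comparison.

Fixpoint comparison_const (l : nat) : nat :=
  match l with
  | 0 => 0
  | 1 => 1
  | l'.+1 => (15 * l * (2 + comparison_const l'))%N
  end.

Definition total_const : nat := \sum_(l < 7) comparison_const l.

Section Compare.
Variables (R : realType) (T : finType) (e : rel T) (k : nat).
Hypotheses (esym : symmetric e) (eirr : irreflexive e).
Notation col := {ffun T -> 'I_k}.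
Notation proper := (proper_coloring e).
Hypothesis spare : forall (s : col) w, (k <= 5 * #|avail e s w :\ s w|)%N.
Hypothesis degk : forall w, (#|[set u | e w u]| <= k)%N.
Hypothesis k0 : (0 < k)%N.
Variable f : col -> R.

Lemma flip_form_le l : flip_form e f l <= (comparison_const l)%:R * site_form e f.
Proof.
elim: l => [|[|l] IH]; first by rewrite flip_form0 mul0r.
  by rewrite mul1r; apply: flip_form1.
apply: le_trans (flip_form_noncut esym f _) _ => //.
have -> : (comparison_const l.+2)%:R = l.+2%:R * (15 * (2 + (comparison_const l.+1)%:R)) :> R.
  by rewrite [comparison_const l.+2]/= !natrM natrD mulrCA mulrA.
rewrite -mulrA; apply: ler_wpM2l; first by rewrite ler0n.
apply: le_trans (noncut_form_le esym eirr f spare degk k0 l) _.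
by move: IH; move: (comparison_const _)%:R => x IH; lra.
Qed.

Lemma dirichlet_le : - inner e f (gen e f) <= total_const%:R * site_form e f.
Proof.
rewrite (dirichlet esym f).
apply: (@le_trans _ _ (\sum_(l < 7) flip_form e f l)); last first.
  rewrite natr_sum mulr_suml; apply: ler_sum => l _; exact: flip_form_le.
have -> : \sum_(l < 7) flip_form e f l = \sum_(j : col * (T * 'I_k) | proper j.1)
    \sum_(l < 7) (#|cluster e j.1 j.2.1 j.2.2| == l)%:R *
     (f (flip e j.1 j.2.1 j.2.2) - f j.1) ^+ 2.
  rewrite [RHS]exchange_big /=; apply: eq_bigr => l _.
  by rewrite (sum_triple e (fun s j => (#|cluster e s j.1 j.2| == l)%:R *
     (f (flip e s j.1 j.2) - f s) ^+ 2)).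
rewrite mulr_sumr; apply: ler_sum => j _; rewrite -mulr_suml mulrA.
apply: ler_wpM2r; first exact: sqr_ge0.
have /andP[w0 w1] := fweightP R e j.1 j.2.
have [c7|c7] := ltnP #|cluster e j.1 j.2.1 j.2.2| 7.
  rewrite (bigD1 (Ordinal c7)) //= eqxx mulr1n.
  have : 0 <= \sum_(i < 7 | i != Ordinal c7) (#|cluster e j.1 j.2.1 j.2.2| == i)%:R :> R.
    by apply: sumr_ge0 => i _; rewrite ler0n.
  by move: w0 w1; lra.
rewrite /fweight flip_prob_large // mul0r mulr0.
by apply: sumr_ge0 => i _; rewrite ler0n.
Qed.

End Compare.

(** * Glauber dynamics *)

Section Glauber.
Variables (R : realType) (T : finType) (e : rel T) (k : nat).
Hypotheses (esym : symmetric e) (eirr : irreflexive e).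
Notation col := {ffun T -> 'I_k}.
Notation proper := (proper_coloring e).
Implicit Types (s t : col) (v w : T) (g h : col -> R).
Notation A s v := (avail e s v).
Notation a s v := (#|avail e s v|%:R : R).

Definition site_avg v g s : R := (a s v)^-1 * \sum_(c in A s v) g (recolor s v c).
Definition glauber_op g s : R := #|T|%:R^-1 * \sum_v site_avg v g s.

Lemma avail_recolor s v c : A (recolor s v c) v = A s v.
Proof.
apply/setP => c'; apply/availP/availP => H u vu; have := H u vu; rewrite ffunE.
  by case: (eqVneq u v) vu => [->|//]; rewrite eirr.
by case: (eqVneq u v) vu => [->|//]; rewrite eirr.
Qed.

Lemma proper_avail s v : proper s -> s v \in A s v.
Proof. by move/proper_coloringP => sp; apply/availP => u vu; rewrite eq_sym sp. Qed.

Lemma avail_gt0 s v : proper s -> 0 < a s v.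
Proof. by move=> sp; rewrite ltr0n; apply/card_gt0P; exists (s v); apply: proper_avail. Qed.

Lemma site_avg_recolor v g s c : site_avg v g (recolor s v c) = site_avg v g s.
Proof.
rewrite /site_avg avail_recolor; congr (_ * _); apply: eq_bigr => c' _; congr g.
by apply/ffunP => y; rewrite !ffunE; case: eqP.
Qed.

Lemma sum_site_avg v g h :
  \sum_(s | proper s) h s * site_avg v g s = \sum_(s | proper s) site_avg v h s * g s.
Proof.
have E (x y : col -> R) : \sum_(s | proper s) x s * site_avg v y s =
    \sum_(s | proper s) \sum_(c in A s v) (a s v)^-1 * (x s * y (recolor s v c)).
  by apply: eq_bigr => s _; rewrite /site_avg mulrCA !mulr_sumr.
rewrite E -(sum_recolor esym eirr v (fun s c => (a s v)^-1 * (h s * g (recolor s v c)))).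
under [RHS]eq_bigr do rewrite mulrC.
rewrite E; apply: eq_bigr => s _; apply: eq_bigr => c _.
by rewrite avail_recolor recolorK (mulrC (g s)).
Qed.

Lemma site_avg_const v x s : proper s -> site_avg v (fun=> x) s = x.
Proof.
move=> sp; rewrite /site_avg sumr_const -[x *+ _]mulr_natl mulrA mulVf ?mul1r //.
by rewrite gt_eqF // avail_gt0.
Qed.

Lemma site_avg_idem v g s : proper s -> site_avg v (site_avg v g) s = site_avg v g s.
Proof.
move=> sp; rewrite -[RHS](@site_avg_const v _ s sp) {1 3}/site_avg; congr (_ * _).
by apply: eq_bigr => c _; rewrite site_avg_recolor.
Qed.

Lemma site_avg_norm v g :
  \sum_(s | proper s) site_avg v g s ^+ 2 = \sum_(s | proper s) g s * site_avg v g s.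
Proof.
transitivity (\sum_(s | proper s) site_avg v g s * site_avg v g s).
  by apply: eq_bigr => s _; rewrite expr2.
rewrite -sum_site_avg; apply: eq_bigr => s sp.
by rewrite site_avg_idem.
Qed.

Lemma site_avg_decay v g :
  \sum_(s | proper s) site_avg v g s ^+ 2 <= \sum_(s | proper s) g s ^+ 2 -
  (2 * k%:R)^-1 * \sum_(s | proper s) \sum_(c in A s v) (g (recolor s v c) - g s) ^+ 2.
Proof.
have e1 : \sum_(s | proper s) g s ^+ 2 =
    \sum_(s | proper s) \sum_(c in A s v) (a s v)^-1 * g (recolor s v c) ^+ 2.
  transitivity (\sum_(s | proper s) \sum_(c in A s v) (a s v)^-1 * g s ^+ 2).
    apply: eq_bigr => s sp; rewrite sumr_const -[_ *+ _]mulr_natl mulrA divff ?mul1r //.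
    by rewrite gt_eqF // avail_gt0.
  rewrite -(sum_recolor esym eirr v (fun s c => (a s v)^-1 * g s ^+ 2)).
  by do 2 (apply: eq_bigr => ? _); rewrite avail_recolor.
have e2 : \sum_(s | proper s) site_avg v g s ^+ 2 = \sum_(s | proper s) g s ^+ 2 -
    2^-1 * \sum_(s | proper s) \sum_(c in A s v) (a s v)^-1 * (g (recolor s v c) - g s) ^+ 2.
  have e3 : \sum_(s | proper s) \sum_(c in A s v) (a s v)^-1 * (g (recolor s v c) - g s) ^+ 2 =
     \sum_(s | proper s) g s ^+ 2 + \sum_(s | proper s) g s ^+ 2 -
     2 * \sum_(s | proper s) site_avg v g s ^+ 2.
    rewrite {1}e1 site_avg_norm mulr_sumr -big_split -sumrB /=; apply: eq_bigr => s sp.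
    have -> : g s ^+ 2 = \sum_(c in A s v) (a s v)^-1 * g s ^+ 2.
      rewrite sumr_const -[_ *+ _]mulr_natl mulrA divff ?mul1r //.
      by rewrite gt_eqF // avail_gt0.
    rewrite /site_avg !mulr_sumr -big_split -sumrB /=; apply: eq_bigr => c _; ring.
  by rewrite e3; lra.
rewrite e2 lerD2l lerN2 invfM -mulrA ler_pM2l ?invr_gt0 ?ltr0n // mulr_sumr.
apply: ler_sum => s sp; rewrite mulr_sumr; apply: ler_sum => c _.
apply: ler_wpM2r; first exact: sqr_ge0.
rewrite lef_pV2 ?posrE ?avail_gt0 //.
  by rewrite ler_nat -[X in (_ <= X)%N]card_ord max_card.
have := avail_gt0 v sp; rewrite !ltr0n => /leq_trans; apply.
by rewrite -[X in (_ <= X)%N]card_ord max_card.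
Qed.

Lemma glauber_op_decay g : (0 < #|T|)%N ->
  \sum_(s | proper s) glauber_op g s ^+ 2 <= \sum_(s | proper s) g s ^+ 2 -
  (2 * #|T|%:R * k%:R)^-1 * site_form e g.
Proof.
move=> n0; have np : 0 < #|T|%:R :> R by rewrite ltr0n.
apply: (@le_trans _ _ (#|T|%:R^-1 * \sum_v \sum_(s | proper s) site_avg v g s ^+ 2)).
  rewrite exchange_big /= mulr_sumr; apply: ler_sum => s _.
  rewrite /glauber_op exprMn expr2 -mulrA ler_pM2l ?invr_gt0 //.
  rewrite ler_pdivrMl //.
  have := sqr_sum_le xpredT (fun=> 1) (fun v => site_avg v g s).
  rewrite [X in X ^+ 2 <= _](eq_bigr (fun v => site_avg v g s)) => [H|v _]; last by rewrite mul1r.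
  by apply: le_trans H _; rewrite expr1n sumr_const.
have H : \sum_v \sum_(s | proper s) site_avg v g s ^+ 2 <=
    #|T|%:R * \sum_(s | proper s) g s ^+ 2 - (2 * k%:R)^-1 * site_form e g.
  apply: le_trans (ler_sum _ (fun v _ => site_avg_decay v g)) _.
  rewrite sumrB sumr_const -mulr_sumr -[X in X - _ <= _]mulr_natl /site_form.
  by rewrite [X in _ <= _ - _ * X]exchange_big.
rewrite ler_pdivrMl //; apply: le_trans H _; rewrite mulrBr lerD2l lerN2 mulrA.
rewrite ler_wpM2r ?site_form_ge0 //.
rewrite le_eqVlt; apply/orP; left; apply/eqP.
by rewrite !invfM mulrA (mulrCA #|T|%:R) divff ?mulr1 // gt_eqF.
Qed.

End Glauber.

Section GlauberDist.
Variables (R : realType) (T : finType) (e : rel T) (k : nat).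
Hypotheses (esym : symmetric e) (eirr : irreflexive e).
Notation col := {ffun T -> 'I_k}.
Notation proper := (proper_coloring e).
Implicit Types (s t : col) (v w : T) (g h : col -> R).
Notation A s v := (avail e s v).

Lemma glauber_P_sum g t : \sum_s glauber_P R e t s * g s = glauber_op e g t.
Proof.
rewrite /glauber_P /glauber_op; under eq_bigr => s _ do rewrite -mulrA mulr_suml.
rewrite -mulr_sumr exchange_big /=; congr (_ * _); apply: eq_bigr => v _.
rewrite /site_avg mulr_sumr.
rewrite [RHS](eq_bigr (fun c => (#|A t v|%:R)^-1 * g (recolor t v c))) //.
transitivity (\sum_(s : col | [forall u, (u != v) ==> (s u == t u)] && (s v \in A t v))
   (#|A t v|%:R)^-1 * g s).
  by rewrite [RHS]big_mkcond; apply: eq_bigr => s _; case: ifP; rewrite ?mul0r.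
rewrite (reindex_onto (fun c => recolor t v c) (fun s => s v)) /=; last first.
  move=> s /andP[/forallP H _]; apply/ffunP => u; rewrite ffunE.
  by case: (eqVneq u v) => [->//|uv]; have := H u; rewrite uv => /eqP.
apply: eq_bigl => c; rewrite !ffunE !eqxx andbT.
suff -> : [forall u, (u != v) ==> (recolor t v c u == t u)] by [].
by apply/forallP => u; rewrite ffunE; case: (eqVneq u v) => /=.
Qed.

Lemma avail_agree s t v : (forall u, u != v -> s u = t u) -> A s v = A t v.
Proof.
move=> st; apply/setP => c; apply/availP/availP => H u vu; have := H u vu.
  by rewrite st //; apply: contraTneq vu => ->; rewrite eirr.
by rewrite st //; apply: contraTneq vu => ->; rewrite eirr.
Qed.

Lemma glauber_P_sym s t : proper s -> proper t -> glauber_P R e s t = glauber_P R e t s.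
Proof.
move=> sp tp; congr (_ * _); apply: eq_bigr => v _.
have [/forallP H|nH] := boolP [forall u, (u != v) ==> (t u == s u)].
  have st u : u != v -> s u = t u by move=> uv; have := H u; rewrite uv => /eqP.
  have -> : [forall u, (u != v) ==> (s u == t u)].
    by apply/forallP => u; apply/implyP => /st ->.
  by rewrite (avail_agree st) proper_avail // -(avail_agree st) proper_avail.
case: ifP => // /andP[/forallP H _]; case/negP: nH.
by apply/forallP => u; rewrite [t u == _]eq_sym H.
Qed.

Lemma glauber_P_proper s t : proper s -> ~~ proper t -> glauber_P R e s t = 0.
Proof.
move=> sp tp; rewrite /glauber_P big1 ?mulr0 // => v _; case: ifP => // /andP[/forallP H tv].
case/negP: tp; suff -> : t = recolor s v (t v) by apply: recolor_proper.
apply/ffunP => u; rewrite ffunE; case: (eqVneq u v) => [->//|uv].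
by have := H u; rewrite uv => /eqP.
Qed.

Section Start.
Variable s0 : col.
Hypothesis s0p : proper s0.
Notation mu m := (glauber_dist R e m s0).

Lemma glauber_dist_support m s : ~~ proper s -> mu m s = 0.
Proof.
elim: m s => [|m IH] s sp /=; first by case: eqP sp => [->|//]; rewrite s0p.
apply: big1 => s' _; have [s'p|s'p] := boolP (proper s'); last by rewrite IH ?mul0r.
by rewrite glauber_P_proper ?mulr0.
Qed.

Lemma glauber_dist_step m t : proper t -> mu m.+1 t = glauber_op e (mu m) t.
Proof.
move=> tp; rewrite -glauber_P_sum.
transitivity (\sum_s mu m s * glauber_P R e s t); first by [].
apply: eq_bigr => s _; rewrite mulrC.
have [sp|sp] := boolP (proper s); first by rewrite glauber_P_sym.
by rewrite glauber_dist_support // !mulr0.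
Qed.

Notation pi := (unif_proper R e (k := k)).
Notation N := (#|[set s' : col | proper s']|%:R : R).
Definition glauber_err m s : R := mu m s - pi s.
Notation err := glauber_err.

Hypothesis n0 : (0 < #|T|)%N.

Lemma N_gt0 : 0 < N.
Proof. by rewrite ltr0n; apply/card_gt0P; exists s0; rewrite inE. Qed.

Lemma sum_glauber_op g : \sum_(s | proper s) glauber_op e g s = \sum_(s | proper s) g s.
Proof.
have np : #|T|%:R != 0 :> R by rewrite pnatr_eq0 -lt0n.
rewrite /glauber_op -mulr_sumr exchange_big /=.
rewrite (eq_bigr (fun=> \sum_(s | proper s) g s)) => [|v _].
  by rewrite sumr_const -[X in _ * X]mulr_natl mulKf.
transitivity (\sum_(s | proper s) 1 * site_avg e v g s).
  by apply: eq_bigr => s _; rewrite mul1r.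
rewrite (sum_site_avg esym eirr v g (fun=> 1)); apply: eq_bigr => s sp.
by rewrite site_avg_const ?mul1r.
Qed.

Lemma err_step m s : proper s -> err m.+1 s = glauber_op e (err m) s.
Proof.
move=> sp; have np : #|T|%:R != 0 :> R by rewrite pnatr_eq0 -lt0n.
have piE : pi s = glauber_op e pi s.
  rewrite {1}/unif_proper sp /glauber_op (eq_bigr (fun=> N^-1)) => [|v _].
    by rewrite sumr_const -[X in _ * X]mulr_natl mulKf.
  rewrite -[RHS](site_avg_const v _ sp); congr (_ * _); apply: eq_bigr => c cA.
  by rewrite /unif_proper recolor_proper.
rewrite /glauber_err glauber_dist_step // piE.
rewrite /glauber_op -mulrBr -sumrB; congr (_ * _); apply: eq_bigr => v _.
by rewrite /site_avg -mulrBr -sumrB.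
Qed.

Lemma err_mean m : \sum_(s | proper s) err m s = 0.
Proof.
have -> : \sum_(s | proper s) err m s = \sum_(s | proper s) mu m s - 1.
  rewrite sumrB; congr (_ - _); rewrite (eq_bigr (fun=> N^-1)) => [|s sp].
    rewrite sumr_const -[_ *+ _]mulr_natl (eq_card (B := [set s' : col | proper s'])).
      by rewrite divff // gt_eqF // N_gt0.
    by move=> s; rewrite inE.
  by rewrite /unif_proper sp.
apply/eqP; rewrite subr_eq0; apply/eqP; elim: m => [|m IH].
  rewrite (bigD1 s0) //= eqxx big1 ?addr0 // => s /andP[_ /negbTE ->] //.
apply: etrans IH; rewrite -[RHS]sum_glauber_op; apply: eq_bigr => s sp.
exact: glauber_dist_step.
Qed.

Lemma err_start : \sum_(s | proper s) err 0 s ^+ 2 <= 2.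
Proof.
have Np := N_gt0; have N1 : N^-1 <= 1.
  by rewrite invf_le1 // ler1n -(ltr0n R).
apply: (@le_trans _ _ (\sum_(s | proper s) (mu 0 s + pi s))).
  apply: ler_sum => s sp; rewrite /glauber_err /unif_proper sp /=.
  have : 0 <= N^-1 by rewrite invr_ge0 ltW.
  move: N^-1 N1 => x x1 x0; case: eqP => _; nra.
have := err_mean 0; rewrite /glauber_err sumrB big_split /= => H.
have : \sum_(s | proper s) mu 0 s = 1.
  by rewrite /= (bigD1 s0) //= eqxx big1 ?addr0 // => s /andP[_ /negbTE ->].
by move: H => /=; lra.
Qed.

Lemma dTV_err m : (2 * dTV (mu m) pi) ^+ 2 <= N * \sum_(s | proper s) err m s ^+ 2.
Proof.
have -> : 2 * dTV (mu m) pi = \sum_(s | proper s) 1 * `|err m s|.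
  rewrite /dTV mulrA divff ?pnatr_eq0 // mul1r (bigID (fun s => proper s)) /=.
  rewrite [X in _ + X]big1 ?addr0 => [|s sp].
    by apply: eq_bigr => s _; rewrite mul1r.
  by rewrite glauber_dist_support // /unif_proper (negbTE sp) subr0 normr0.
apply: le_trans (sqr_sum_le _ _ _) _.
rewrite expr1n sumr_const (eq_card (B := [set s' : col | proper s'])); last first.
  by move=> s; rewrite inE.
rewrite ler_pM2l ?N_gt0 //; apply: ler_sum => s _.
by rewrite real_normK ?num_real.
Qed.

End Start.
End GlauberDist.

Lemma ln_ge_half (R : realType) (n : nat) : (2 <= n)%N -> 2^-1 <= ln (n%:R : R).
Proof.
move=> n2; have np : 0 < n%:R :> R by rewrite ltr0n; apply: leq_trans n2.
rewrite -ler_expR lnK ?posrE //; apply: (@le_trans _ _ 2); last by rewrite ler_nat.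
have h := expR_ge1Dx (- 2^-1 : R); have hp := expR_gt0 (- 2^-1 : R).
have : expR (2^-1) * expR (- 2^-1) = 1 :> R by rewrite -expRD subrr expR0.
have := expR_gt0 (2^-1 : R); nra.
Qed.

Lemma spare_colors (R : realType) (d k a : nat) : (d + 2 <= k)%N ->
  (11 / 6 - 94 / 10 ^+ 6) * d%:R <= k%:R :> R -> (k <= a + d)%N -> (k <= 5 * (a - 1))%N.
Proof.
move=> dk dkR ka; have : (5 * d + 5 <= 4 * k)%N; last by lia.
have [d3|d3] := leqP d 3; first by lia.
have d4R : 4 <= d%:R :> R by rewrite ler_nat.
rewrite -(ler_nat R) natrD !natrM; move: dkR; rewrite -natrX; lra.
Qed.

Definition mixing_const : nat := 20 * total_const.

Lemma total_const_gt0 : (0 < total_const)%N.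
Proof. by rewrite /total_const (bigD1 (Ordinal (isT : (1 < 7)%N))). Qed.

Section Mixing.
Variables (R : realType) (T : finType) (e : rel T) (k : nat).
Hypotheses (esym : symmetric e) (eirr : irreflexive e).
Notation col := {ffun T -> 'I_k}.
Notation proper := (proper_coloring e).
Hypotheses (n2 : (2 <= #|T|)%N) (dk : (max_degree e + 2 <= k)%N).
Hypothesis dkR : (11 / 6 - 94 / 10 ^+ 6) * (max_degree e)%:R <= k%:R :> R.
Notation gam := ((1000 * mixing_const%:R * #|T|%:R)^-1 : R).

Lemma poincare (f : col -> R) : \sum_(s | proper s) f s = 0 ->
  k%:R / 10000 * \sum_(s | proper s) f s ^+ 2 <= total_const%:R * site_form e f.
Proof.
move=> f0; have n0 : (0 < #|T|)%N by apply: ltnW.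
have deg w : (#|[set u | e w u]| <= max_degree e)%N by apply: deg_le_max.
have spare (s : col) w : (k <= 5 * #|avail e s w :\ s w|)%N.
  have kA : (k <= #|avail e s w| + max_degree e)%N.
    by apply: leq_trans (card_avail e s w) _; rewrite leq_add2l.
  apply: leq_trans (spare_colors dk dkR kA) _.
  rewrite leq_mul2l /= leq_subLR; have := cardsD1 (s w) (avail e s w) => ->.
  by rewrite leq_add2r leq_b1.
have degk w : (#|[set u | e w u]| <= k)%N.
  by apply: leq_trans (deg w) _; apply: leq_trans dk; apply: leq_addr.
have k0 : (0 < k)%N by apply: leq_trans dk; rewrite addnC.
apply: le_trans (dirichlet_le esym eirr spare degk k0 f).
have := flip_gap esym eirr dk dkR n0 f0.
by rewrite /inner; under eq_bigr do rewrite -expr2.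
Qed.

Lemma err_decay (s0 : col) m : proper s0 ->
  \sum_(s | proper s) glauber_err R e s0 m s ^+ 2 <= 2 * expR (- gam * m%:R).
Proof.
move=> s0p; have n0 : (0 < #|T|)%N by apply: ltnW.
have np : 0 < #|T|%:R :> R by rewrite ltr0n.
have kp : 0 < k%:R :> R by rewrite ltr0n; apply: leq_trans dk; rewrite addnC.
have Cp : 0 < total_const%:R :> R by rewrite ltr0n total_const_gt0.
elim: m => [|m IH]; first by rewrite mulr0 expR0 mulr1; apply: err_start.
have step : \sum_(s | proper s) glauber_err R e s0 m.+1 s ^+ 2 <=
    (1 - gam) * \sum_(s | proper s) glauber_err R e s0 m s ^+ 2.
  rewrite (eq_bigr (fun s => glauber_op e (glauber_err R e s0 m) s ^+ 2)) => [|s sp]; last first.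
    by rewrite err_step.
  apply: le_trans (glauber_op_decay esym eirr _ n0) _.
  have := poincare (err_mean R esym eirr s0p n0 m).
  move: (\sum_(s | proper s) _) (site_form _ _) => b S H.
  rewrite mulrBl mul1r lerD2l lerN2 /mixing_const natrM.
  rewrite ler_pdivlMl ?mulr_gt0 //.
  rewrite mulrCA ler_pdivrMl ?mulr_gt0 //.
  have := ler_wpM2l (ltW np) H; nra.
apply: le_trans step _.
apply: (@le_trans _ _ (expR (- gam) * (2 * expR (- gam * m%:R)))); last first.
  by rewrite mulrCA -expRD -{1}[- gam]mulr1 -mulrDr nat1r.
have g1 := expR_ge1Dx (- gam).
apply: le_trans (ler_wpM2r _ g1) _; first by apply: sumr_ge0 => s _; apply: sqr_ge0.
by apply: ler_wpM2l => //; apply: ltW; apply: expR_gt0.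
Qed.

Lemma glauber_mixes (s0 : col) (t : nat) : proper s0 ->
  8 * (1000 * mixing_const%:R) * ((#|T|%:R) ^+ 2 * ln (#|T|%:R : R) * ln (k%:R : R)) <= t%:R ->
  dTV (glauber_dist R e t s0) (unif_proper R e (k:=k)) <= (2 * expR 1)^-1.
Proof.
move=> s0p ht; have n0 : (0 < #|T|)%N by apply: ltnW.
have np : 0 < #|T|%:R :> R by rewrite ltr0n.
have k2 : (2 <= k)%N by apply: leq_trans dk; apply: leq_addl.
have kp : 0 < k%:R :> R by rewrite ltr0n; apply: leq_trans k2.
have Cp : 0 < mixing_const%:R :> R by rewrite ltr0n muln_gt0 total_const_gt0.
have lnn := ln_ge_half R n2; have lnk := ln_ge_half R k2.
have n2R : 2 <= #|T|%:R :> R by rewrite ler_nat.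
set N : R := #|[set s' : col | proper s']|%:R.
have Nk : N <= expR (#|T|%:R * ln k%:R).
  rewrite mulrC expRM_natr lnK ?posrE // -natrX ler_nat.
  by apply: leq_trans (max_card _) _; rewrite card_ffun card_ord.
have gt : #|T|%:R * ln k%:R + 3 <= gam * t%:R.
  have nk1 : 1 <= #|T|%:R * ln k%:R :> R.
    by apply: (@le_trans _ _ (2 * 2^-1)); [lra | apply: ler_pM; rewrite // invr_ge0].
  apply: (@le_trans _ _ (8 * (#|T|%:R * ln #|T|%:R * ln k%:R))).
    have : #|T|%:R * ln k%:R / 2 <= #|T|%:R * ln #|T|%:R * ln k%:R :> R.
      rewrite mulrAC; apply: ler_wpM2r; first by apply: le_trans lnk; rewrite invr_ge0.
      by apply: ler_wpM2l; first exact: ltW.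
    by lra.
  rewrite ler_pdivlMl ?mulr_gt0 //; apply: le_trans ht.
  by rewrite le_eqVlt; apply/orP; left; apply/eqP; ring.
have e1 : 2 <= expR 1 :> R by have := expR_ge1Dx (1 : R); lra.
have main : (2 * dTV (glauber_dist R e t s0) (unif_proper R e (k:=k))) ^+ 2 <= expR (-1) ^+ 2.
  apply: le_trans (dTV_err R esym eirr s0p t) _.
  apply: le_trans (ler_wpM2l _ (err_decay t s0p)) _; first by rewrite ler0n.
  apply: (@le_trans _ _ (expR (#|T|%:R * ln k%:R) * (expR 1 * expR (- gam * t%:R)))).
    apply: ler_pM => //; first by rewrite mulr_ge0 // ltW // expR_gt0.
    by rewrite ler_wpM2r // ltW // expR_gt0.
  by rewrite -!expRD -expRM_natr ler_expR mulNr; lra.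
have d0 : 0 <= dTV (glauber_dist R e t s0) (unif_proper R e (k:=k)).
  by rewrite mulr_ge0 ?invr_ge0 // sumr_ge0.
have H : 2 * dTV (glauber_dist R e t s0) (unif_proper R e (k:=k)) <= expR (-1).
  have e0 : 0 <= expR (-1) :> R by apply/ltW/expR_gt0.
  by rewrite -(@ler_pXn2r _ 2) // nnegrE // mulr_ge0.
by rewrite invfM -expRN ler_pdivlMl.
Qed.

End Mixing.

Theorem theorem1p2 (R : realType) :
  exists eps0 : R, 94 / 10 ^+ 6 <= eps0 /\
  exists C : R, 0 < C /\
  forall (T : finType) (e : rel T), symmetric e -> irreflexive e ->
  forall k : nat,
    (2 <= #|T|)%N ->
    (max_degree e + 2 <= k)%N ->
    (11 / 6 - eps0) * (max_degree e)%:R <= k%:R ->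
  forall s0 : {ffun T -> 'I_k}, proper_coloring e s0 ->
  forall t : nat,
    C * ((#|T|%:R) ^+ 2 * ln (#|T|%:R : R) * ln (k%:R : R)) <= t%:R ->
    dTV (glauber_dist R e t s0) (unif_proper R e (k:=k)) <= (2 * expR 1)^-1.
Proof.
exists (94 / 10 ^+ 6); split=> //; exists (8 * (1000 * mixing_const%:R)); split.
  by rewrite !mulr_gt0 // ltr0n muln_gt0 total_const_gt0.
by move=> T e esym eirr k n2 dk dkR s0 s0p t; apply: glauber_mixes.
Qed.
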